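(* Let $k,d\in\mathbb{N}$ satisfy $3\leq k\leq d$. There exists a constant $C=C_{k,d}>0$, depending only on $k$ and $d$, such that for every odd prime power $q$, every $t\in\mathbb{F}_q\setminus\{0\}$ and every $E\subset\mathbb{F}_q^d$ the following holds: if $$|E|>Cq^{d-\left\lfloor \frac{d-k}{3}\right\rfloor-1},$$ then the $t$-distance graph $G_t(E)$ has VC-dimension at least $k$.
   Context: For $x,y\in\mathbb{F}_q^d$ write $\|x-y\|=\sum_{i=1}^d (x_i-y_i)^2\in\mathbb{F}_q$. For $E\subset\mathbb{F}_q^d$ and $t\in\mathbb{F}_q$, the $t$-distance graph $G_t(E)$ is the graph with vertex set $E$ in which $x\sim y$ if and only if $\|x-y\|=t$. VC-dimension: if $V$ is a set and $\mathcal{H}\subset\{0,1\}^V$ is a family of functions, $\mathcal{H}$ shatters a finite set $S\subset V$ if $\{0,1\}^S=\{h|_S:h\in\mathcal{H}\}$; the VC-dimension of $\mathcal{H}$ is the largest $n$ such that $\mathcal{H}$ shatters some set of size $n$ (infinite if no such $n$ exists). For a graph $G$ with vertex set $V$, let $N(x)=\{y\in V:x\sim y\}$ and $N[x]=\{x\}\cup N(x)$ be the neighborhood and closed neighborhood of $x\in V$. The VC-dimension of the graph $G$ is the VC-dimension of the family $\{\mathbf{1}_{N[x]}:x\in V\}$ of indicator functions. *)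

(* Defs.v *)
From mathcomp Require Import all_boot all_order all_algebra.
From mathcomp Require Import reals.

Set Implicit Arguments.
Unset Strict Implicit.
Unset Printing Implicit Defensive.

Import Order.TTheory GRing.Theory Num.Theory.

Local Open Scope ring_scope.

Section VCDimension.
Variable V : finType.
Implicit Types (S : {set V}) (H : {set {ffun V -> bool}}).

Definition restriction S (h : {ffun V -> bool}) :
    {ffun {x : V | x \in S} -> bool} :=
  [ffun x => h (val x)].

Definition shatters H S : bool :=
  [set restriction S h | h in H] == [set: {ffun {x : V | x \in S} -> bool}].

(* As V is finite, a nonempty H shatters set0 and the sizes of the sets it    *)
(* shatters are bounded, so the largest one exists.  The empty family         *)
(* shatters nothing and gets the value 0.                                     *)
Definition VCdim H : nat := (\max_(S : {set V} | shatters H S) #|S|)%N.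

End VCDimension.

Section GraphVCDimension.
Variables (V : finType) (adj : rel V).

Definition neighborhood (x : V) : {set V} := [set y | adj x y].

Definition closed_neighborhood (x : V) : {set V} := x |: neighborhood x.

Definition indicator (A : {set V}) : {ffun V -> bool} := [ffun y => y \in A].

Definition graph_VCdim : nat :=
  VCdim [set indicator (closed_neighborhood x) | x : V].

End GraphVCDimension.

Section DistanceGraph.
Variables (F : finFieldType) (d : nat).

(* The values lie in F: this is a quadratic form and not a metric.            *)
Definition sqnorm (x : 'rV[F]_d) : F := \sum_(i < d) x 0 i ^+ 2.

(* The vertices are the elements of E, so that both the centres of the        *)
(* neighborhoods and the shattered points are taken in E.                     *)
Definition distance_graph (t : F) (E : {set 'rV[F]_d}) :
    rel {x : 'rV[F]_d | x \in E} :=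
  fun x y => sqnorm (val x - val y) == t.

End DistanceGraph.

(* Main.v *)
(* Write q = #|F|, n = #|E| and E_S(x) for the set of points of E adjacent to
   x_i for every i in S.  A random point y of E and random neighbours
   x_1, ..., x_k of y in E form a shattered set with positive probability.

   Every E_S(x) with |S| < k has size at least eps n / q^|S|: a double count of
   the pairs (y, x) for which it is smaller uses only that typical degrees are
   at least n / 2q.  No E_{S + j}(x) takes up more than a small proportion of
   that lower bound: the moments of the codegrees of y bound the expected size
   of E_{S + j}(x), by means of a second moment estimate for the neighbours of
   y, where an inversion centred at y turns spheres through y into hyperplanes.
   The one case out of reach of this estimate is |S + j| = k = d; there the
   x_i - y are independent with high probability, and then the d spheres have at
   most two common points.  Hence E_S(x) contains a point adjacent to no x_j with
   j outside S.

   The degrees are controlled by lifting spheres to hyperplanes in dimension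
   d + 1, which is enough for d > 3.  For d = 3 pairs of spheres are intersected
   exactly: the variance for radius s is controlled by the numbers of pairs of
   E at distances 0 and 4s, and the radius s <> 0 maximizing the number of
   pairs closes the estimate. *)
Require Import Defs.
From mathcomp Require Import all_boot all_order all_fingroup all_algebra all_solvable.
From mathcomp Require Import reals ring lra zify.

Set Implicit Arguments.
Unset Strict Implicit.
Unset Printing Implicit Defensive.

Import Order.TTheory GRing.Theory Num.Theory.

Local Open Scope ring_scope.

(** * Second moments and the dot product *)

(** [#|F|] copies of 1 sum to 0 by Lagrange in the additive group; if 2 were 0, an odd number of
    copies would sum to 1. *)
Lemma odd_card_two_neq0 (F : finFieldType) : odd #|F| -> 2 != 0 :> F.
Proof.
move=> oddF; apply/eqP => two0.
have : (1 : F) *+ #|F| = 0.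
  by apply/eqP; rewrite -FinRing.zmodXgE -cardsT -order_dvdn order_dvdG ?inE.
rewrite -(odd_double_half #|F|) oddF -muln2 mulnC mulrnDr mulrnA two0 mul0rn.
by rewrite addr0 => /eqP; rewrite oner_eq0.
Qed.

Lemma card_sum_fibers (T J : finType) (A : pred T) (f : T -> J) :
  #|A| = (\sum_(j : J) #|[set x in A | f x == j]|)%N.
Proof.
rewrite -sum1_card (partition_big f predT) //=; apply: eq_bigr => j _.
by rewrite -sum1_card; apply: eq_bigl => x; rewrite inE.
Qed.

Lemma natr_cardE (R : pzSemiRingType) (T : finType) (A : pred T) :
  #|A|%:R = \sum_(x : T) (x \in A)%:R :> R.
Proof. by rewrite -sum1_card natr_sum big_mkcond; apply: eq_bigr => x _; case: ifP. Qed.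

Lemma natr_cardsE (R : pzSemiRingType) (T : finType) (X : {set T}) (p : pred T) :
  #|[set x in X | p x]|%:R = \sum_(x in X) (p x)%:R :> R.
Proof.
rewrite natr_cardE [RHS]big_mkcond; apply: eq_bigr => x _.
by rewrite inE; case: (x \in X).
Qed.

Section SecondMoment.
Variables (R : realFieldType) (T W : finType) (X : {set T}) (r : T -> W -> bool).

Lemma second_moment (mu : R) :
  \sum_(w : W) (#|[set x in X | r x w]|%:R - mu) ^+ 2 =
  \sum_(x in X) \sum_(x' in X) #|[set w | r x w && r x' w]|%:R
  - 2 * mu * (\sum_(x in X) #|[set w | r x w]|%:R) + mu ^+ 2 * #|W|%:R.
Proof.
under eq_bigr => w _ do rewrite sqrrB natr_cardsE.
rewrite big_split sumrB /=; congr (_ - _ + _).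
- under eq_bigr => w _ do rewrite expr2 mulr_suml.
  rewrite exchange_big; apply: eq_bigr => x xX /=.
  under eq_bigr => w _ do rewrite mulr_sumr.
  rewrite exchange_big; apply: eq_bigr => x' x'X /=.
  rewrite natr_cardE; apply: eq_bigr => w _.
  by rewrite inE -natrM mulnb.
- under eq_bigr => w _ do rewrite -mulr_natl mulrC -mulrA.
  rewrite -mulr_suml exchange_big /= [RHS]mulrC [2 * mu]mulrC; congr (_ * _).
  by apply: eq_bigr => x _; rewrite natr_cardE; apply: eq_bigr => w _; rewrite inE.
- by rewrite sumr_const mulr_natr.
Qed.

(** Each event [r x] has probability [1 / q]. Pairs outside [exc] are correlated no more than
    independent ones, so their contribution is absorbed by the square of the mean; an exceptional
    pair costs at most the probability of a single event. *)
Lemma second_moment_le (q e : nat) (exc : rel T) :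
    (0 < q)%N ->
    (forall x, x \in X -> #|[set w | r x w]| * q = #|W|)%N ->
    (forall x x', x \in X -> x' \in X -> ~~ exc x x' ->
       #|[set w | r x w && r x' w]| * q ^ 2 <= #|W|)%N ->
    (forall x, x \in X -> #|[set x' in X | exc x x']| <= e)%N ->
  \sum_(w : W) (#|[set x in X | r x w]|%:R - #|X|%:R / q%:R) ^+ 2
    <= e%:R * #|X|%:R * #|W|%:R / q%:R :> R.
Proof.
move=> q_gt0 single pair exceptional.
have q0 : q%:R != 0 :> R by rewrite pnatr_eq0 -lt0n.
have qgt0 : 0 < q%:R :> R by rewrite ltr0n.
set w := #|W|%:R : R; set n := #|X|%:R : R.
have singleR x : x \in X -> #|[set w | r x w]|%:R = w / q%:R :> R.
  by move=> xX; rewrite /w -(single x xX) natrM mulfK.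
rewrite second_moment -/w -/n.
have -> : \sum_(x in X) #|[set w | r x w]|%:R = n * (w / q%:R).
  by rewrite (eq_bigr _ singleR) sumr_const -[LHS]mulr_natl.
have le1 x x' : x \in X -> x' \in X -> #|[set w | r x w && r x' w]|%:R
    <= w / q%:R ^+ 2 + (exc x x')%:R * (w / q%:R) :> R.
  move=> xX x'X; case: (boolP (exc x x')) => exc_xx' /=.
    rewrite mul1r -(singleR x xX) ler_wpDl //.
      by rewrite divr_ge0 ?exprn_ge0 ?ler0n.
    rewrite ler_nat subset_leq_card //; apply/subsetP => v.
    by rewrite !inE => /andP[].
  by rewrite mul0r addr0 ler_pdivlMr ?exprn_gt0 // -natrX -natrM ler_nat pair.
have : \sum_(x in X) \sum_(x' in X) #|[set w | r x w && r x' w]|%:R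
    <= \sum_(x in X) (n * (w / q%:R ^+ 2) + e%:R * (w / q%:R)) :> R.
  apply: ler_sum => x xX.
  apply: (@le_trans _ _ (\sum_(x' in X) (w / q%:R ^+ 2 + (exc x x')%:R * (w / q%:R)))).
    by apply: ler_sum => x' x'X; apply: le1.
  rewrite big_split /= sumr_const -[X in X + _]mulr_natl lerD2l -mulr_suml.
  by rewrite ler_wpM2r ?divr_ge0 ?ler0n // -natr_cardsE ler_nat exceptional.
rewrite sumr_const -[X in _ <= X]mulr_natl -/n => le2.
have -> : e%:R * n * w / q%:R = n * (n * (w / q%:R ^+ 2) + e%:R * (w / q%:R)) 
   - 2 * (n / q%:R) * (n * (w / q%:R)) + (n / q%:R) ^+ 2 * w.
  by field.
by rewrite lerD2r lerD2r.
Qed.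

End SecondMoment.

(** * The bilinear form and the sizes of its hyperplanes *)

Section Dot.
Variables (F : finFieldType) (d : nat).
Local Notation V := 'rV[F]_d.
Implicit Types (x y z u v w : V) (a c s t : F).

Definition dot x y : F := \sum_(i < d) x 0 i * y 0 i.

Lemma sqnormE x : sqnorm x = dot x x.
Proof. by apply: eq_bigr => i _; rewrite expr2. Qed.

Lemma dotC x y : dot x y = dot y x.
Proof. by apply: eq_bigr => i _; rewrite mulrC. Qed.

Lemma dotDl x y z : dot (x + y) z = dot x z + dot y z.
Proof. by rewrite -big_split; apply: eq_bigr => i _; rewrite mxE mulrDl. Qed.

Lemma dotDr x y z : dot z (x + y) = dot z x + dot z y.
Proof. by rewrite dotC dotDl !(dotC z). Qed.

Lemma dotZl a x y : dot (a *: x) y = a * dot x y.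
Proof. by rewrite mulr_sumr; apply: eq_bigr => i _; rewrite mxE mulrA. Qed.

Lemma dotZr a x y : dot y (a *: x) = a * dot y x.
Proof. by rewrite dotC dotZl dotC. Qed.

Lemma dotNl x y : dot (- x) y = - dot x y.
Proof. by rewrite -scaleN1r dotZl mulN1r. Qed.

Lemma dotNr x y : dot y (- x) = - dot y x.
Proof. by rewrite dotC dotNl dotC. Qed.

Lemma dotBl x y z : dot (x - y) z = dot x z - dot y z.
Proof. by rewrite dotDl dotNl. Qed.

Lemma dotBr x y z : dot z (x - y) = dot z x - dot z y.
Proof. by rewrite dotDr dotNr. Qed.

Lemma dot0l x : dot 0 x = 0.
Proof. by rewrite -(scale0r x) dotZl mul0r. Qed.

Lemma dot0r x : dot x 0 = 0.
Proof. by rewrite dotC dot0l. Qed.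

Lemma sqnormD x y : sqnorm (x + y) = sqnorm x + 2 * dot x y + sqnorm y.
Proof. by rewrite !sqnormE dotDl !dotDr (dotC y x); ring. Qed.

Lemma sqnormB x y : sqnorm (x - y) = sqnorm x - 2 * dot x y + sqnorm y.
Proof. by rewrite !sqnormE dotBl !dotBr (dotC y x); ring. Qed.

Lemma sqnormZ a x : sqnorm (a *: x) = a ^+ 2 * sqnorm x.
Proof. by rewrite !sqnormE dotZl dotZr mulrA expr2. Qed.

Lemma sqnormN x : sqnorm (- x) = sqnorm x.
Proof. by rewrite -scaleN1r sqnormZ sqrrN expr1n mul1r. Qed.

Lemma sqnorm0 : sqnorm (0 : V) = 0.
Proof. by rewrite sqnormE dot0l. Qed.

Lemma sqnormBC x y : sqnorm (x - y) = sqnorm (y - x).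
Proof. by rewrite -sqnormN opprB. Qed.

Definition dotE := (dotDl, dotDr, dotNl, dotNr, dotZl, dotZr, dot0l, dot0r).

Lemma dot_delta x i : dot x (delta_mx 0 i) = x 0 i.
Proof.
rewrite /dot (bigD1 i) //= mxE !eqxx mulr1 big1 ?addr0 // => j /negPf ji.
by rewrite mxE ji andbF mulr0.
Qed.

Lemma rV_neq0 x : x != 0 -> exists i, x 0 i != 0.
Proof.
move=> x0; apply/existsP; apply: contraR x0 => /existsPn x0.
by apply/eqP/rowP => i; rewrite mxE; apply/eqP/negPn/x0.
Qed.

Lemma dot_unit x : x != 0 -> exists u, dot x u = 1.
Proof.
move=> /rV_neq0[i xi]; exists ((x 0 i)^-1 *: delta_mx 0 i).
by rewrite dotZr dot_delta mulVf.
Qed.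

Lemma dot_unit2 x x' : x != 0 -> (forall c, x' != c *: x) ->
  exists u, dot x u = 0 /\ dot x' u = 1.
Proof.
move=> /rV_neq0[i xi] indep.
(* Subtracting this multiple of [x] kills coordinate [i]; a coordinate [j] that survives yields [u]
   in the span of the basis vectors [i] and [j]. *)
have : x' - (x' 0 i / x 0 i) *: x != 0 by rewrite subr_eq0.
case/rV_neq0 => j; rewrite !mxE => xj.
set b := (_ - _) in xj.
exists (b^-1 *: (delta_mx 0 j - (x 0 j / x 0 i) *: delta_mx 0 i)).
rewrite !dotZr !dotBr !dotZr !dot_delta; split.
  by rewrite mulfVK // subrr mulr0.
rewrite (_ : _ - _ = b) ?mulVf //.
by rewrite /b; field.
Qed.

Lemma card_rV : #|{: V}| = (#|F| ^ d)%N.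
Proof. by rewrite card_mx mul1n. Qed.

(** Translations by multiples of [u] preserve [A] and carry any fibre of [f] onto any other, so all
    [q] fibres have the same size. *)
Lemma card_fiber_shift (A : pred V) (f : V -> F) u a :
    (forall s w, (w + s *: u \in A) = (w \in A)) ->
    (forall s w, f (w + s *: u) = f w + s) ->
  (#|[set w in A | f w == a]| * #|F| = #|A|)%N.
Proof.
move=> invA fu; rewrite [RHS](card_sum_fibers A f) mulnC -sum_nat_const.
apply: eq_bigr => b _.
rewrite -(card_imset _ (addIr ((b - a) *: u))); apply: eq_card => w.
apply/imsetP/idP => [[v]|].
  rewrite !inE => /andP[vA /eqP fv] ->.
  by rewrite invA vA fu fv addrC subrK eqxx.
rewrite !inE => /andP[wA /eqP fw]; exists (w - (b - a) *: u); last by rewrite subrK.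
by rewrite !inE -scaleNr invA wA fu fw opprB addrC subrK eqxx.
Qed.

Lemma card_dot_eq x a : x != 0 -> (#|[set w | dot x w == a]| * #|F| = #|F| ^ d)%N.
Proof.
case/dot_unit=> u xu; rewrite -card_rV -(@card_fiber_shift predT (dot x) u a) //.
by move=> s w; rewrite !dotE xu mulr1.
Qed.

Lemma card_dot_eq2 x x' a b : x != 0 -> (forall c, x' != c *: x) ->
  (#|[set w | (dot x w == a) && (dot x' w == b)]| * #|F| ^ 2 = #|F| ^ d)%N.
Proof.
move=> x0 indep; have [u [xu x'u]] := dot_unit2 x0 indep.
rewrite -(card_dot_eq a x0) expnS expn1 mulnA; congr (_ * _)%N.
rewrite -[RHS](@card_fiber_shift _ (dot x') u b).
- by congr (_ * _)%N; apply: eq_card => w; rewrite !inE.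
- by move=> s w; rewrite !inE !dotE xu mulr0 addr0.
- by move=> s w; rewrite !dotE x'u mulr1.
Qed.

End Dot.

(** * Variance of degrees and codegrees *)

Lemma sum_sub_le (R : realFieldType) (I : finType) (P : pred I) (f : I -> R) :
  (forall i, 0 <= f i) -> \sum_(i | P i) f i <= \sum_i f i.
Proof.
move=> f0; rewrite [X in _ <= X](bigID P) /= ler_wpDr // sumr_ge0 //.
Qed.

Lemma sum_reindex_le (R : realFieldType) (I J : finType) (P : pred I)
    (h : I -> J) (f : J -> R) :
    {in P &, injective h} -> (forall j, 0 <= f j) ->
  \sum_(i | P i) f (h i) <= \sum_j f j.
Proof.
move=> injh f0.
have -> : \sum_(i | P i) f (h i) = \sum_(j in h @: P) f j by rewrite big_imset.
exact: sum_sub_le.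
Qed.

(** A term with [c i <= 2 mu] is at most [(2 mu)^m]; a larger one satisfies [c i <= 2 (c i - mu)],
    so two of its factors are paid for by the variance and the other [m - 2] by [D]. *)
Lemma sum_pow_le (R : realFieldType) (I : finType) (P : pred I) (c : I -> R)
    (D mu S : R) (m : nat) :
    (2 <= m)%N -> 0 <= mu -> 0 <= D -> (forall i, 0 <= c i <= D) ->
    \sum_i (c i - mu) ^+ 2 <= S ->
  \sum_(i | P i) c i ^+ m <= 2 ^+ m * (#|P|%:R * mu ^+ m + D ^+ (m - 2) * S).
Proof.
move=> m2 mu0 D0 cD leS.
have termle i : c i ^+ m <= 2 ^+ m * (mu ^+ m + D ^+ (m - 2) * (c i - mu) ^+ 2).
  have /andP[c0 cD'] := cD i.
  case: (lerP (c i) (2 * mu)) => h.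
    apply: (@le_trans _ _ ((2 * mu) ^+ m)); first by rewrite lerXn2r ?nnegrE //; lra.
    by rewrite exprMn ler_wpM2l ?exprn_ge0 // lerDl mulr_ge0 ?sqr_ge0 ?exprn_ge0.
  rewrite -{1}(subnK m2) exprD.
  apply: (@le_trans _ _ (D ^+ (m - 2) * (4 * (c i - mu) ^+ 2))).
    apply: ler_pM; rewrite ?exprn_ge0 //; first by rewrite lerXn2r ?nnegrE.
    (* This product equals [4 (c i - mu)^2 - (c i)^2]. *)
    have : 0 <= (c i - 2 * mu) * (3 * c i - 2 * mu) by apply: mulr_ge0; lra.
    lra.
  have -> : 4 = 2 ^+ 2 :> R by ring.
  rewrite mulrDr [X in X <= _]mulrCA ler_wpDl ?mulr_ge0 ?exprn_ge0 //.
  rewrite ler_wpM2r ?mulr_ge0 ?sqr_ge0 ?exprn_ge0 //.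
  1,2: by lra.
  by apply: ler_weXn2l; rewrite ?ler1n.
apply: (le_trans (ler_sum _ (fun i _ => termle i))).
rewrite -mulr_sumr ler_wpM2l ?exprn_ge0 // big_split /= sumr_const mulr_natl lerD2l.
rewrite -mulr_sumr ler_wpM2l ?exprn_ge0 //.
by apply: le_trans leS; apply: sum_sub_le => i; apply: sqr_ge0.
Qed.

Lemma card_eq_le1 (T : finType) (X : {set T}) x : (#|[set x' in X | x == x']| <= 1)%N.
Proof.
apply: leq_trans (_ : #|[set x]| <= 1)%N; last by rewrite cards1.
by apply/subset_leq_card/subsetP => x'; rewrite !inE eq_sym => /andP[].
Qed.

Section Variance.
Variables (F : finFieldType) (d : nat) (R : realFieldType).
Hypothesis two_neq0 : 2 != 0 :> F.
Local Notation V := 'rV[F]_d.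
Local Notation q := #|F|.
Implicit Types (x y z w : V) (t : F) (E X : {set V}).

Lemma cardF_gt0 : (0 < q)%N.
Proof. by apply/card_gt0P; exists 0. Qed.

(* The value [sqnorm y] is relaxed to an arbitrary scalar, which turns spheres
   into hyperplanes of a space of dimension d + 1. *)
Lemma degree_variance E t :
  \sum_y (#|[set x in E | sqnorm (x - y) == t]|%:R - #|E|%:R / q%:R) ^+ 2
    <= #|E|%:R * q%:R ^+ d :> R.
Proof.
pose r x (w : V * F) := sqnorm x - 2 * dot x w.1 == w.2.
have graph_inj (f : V -> F) : injective (fun y => (y, f y)) by move=> y y' [].
have := @second_moment_le R _ _ E r q 1 eq_op cardF_gt0.
rewrite card_prod card_rV.
have single x : x \in E -> (#|[set w | r x w]| * q = q ^ d * q)%N.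
  move=> _; rewrite -card_rV -(card_imset predT (graph_inj (fun y => sqnorm x - 2 * dot x y))).
  congr (_ * _)%N; apply: eq_card => -[y c]; rewrite inE /r /=.
  by apply/eqP/imsetP => [<-|[y' _ [-> ->]] //]; exists y.
(* Subtracting the two equations leaves an affine hyperplane with normal [2 (x' - x)] for [y], and
   [y] determines the last coordinate. *)
have pair x x' : x \in E -> x' \in E -> x != x' ->
    (#|[set w | r x w && r x' w]| * q ^ 2 <= q ^ d * q)%N.
  move=> _ _ xx'.
  have v0 : (2 : F) *: (x' - x) != 0.
    by rewrite scaler_eq0 negb_or two_neq0 subr_eq0 eq_sym.
  rewrite -(card_dot_eq (sqnorm x' - sqnorm x) v0) expnS expn1 mulnA leq_mul2r.
  apply/orP; right; rewrite leq_mul2r; apply/orP; right.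
  rewrite -(card_imset _ (graph_inj (fun y => sqnorm x - 2 * dot x y))).
  apply: subset_leq_card; apply/subsetP => -[y c]; rewrite inE /r /=.
  case/andP => /eqP h1 /eqP h2; apply/imsetP; exists y; last by rewrite h1.
  rewrite inE !dotE; apply/eqP.
  have -> : sqnorm x' = sqnorm x - 2 * dot x y + 2 * dot x' y by rewrite h1 -h2 subrK.
  by ring.
move=> /(_ single pair); rewrite mul1r => H.
move: H.
have -> : #|E|%:R * (q ^ d * q)%:R / q%:R = #|E|%:R * q%:R ^+ d :> R.
  by rewrite natrM natrX mulrA mulfK // pnatr_eq0 -lt0n cardF_gt0.
move=> H; apply: le_trans (H _); last first.
  by move=> x _; apply: card_eq_le1.
pose g y c : R := (#|[set x in E | r x (y, c)]|%:R - #|E|%:R / q%:R) ^+ 2.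
have -> : \sum_w (#|[set x in E | r x w]|%:R - #|E|%:R / q%:R) ^+ 2 = \sum_y \sum_c g y c.
  by rewrite pair_bigA; apply: eq_bigr => -[y c] _.
apply: ler_sum => y _; rewrite (bigD1 (t - sqnorm y)) //=; apply: ler_wpDr.
  by apply: sumr_ge0 => c _; apply: sqr_ge0.
rewrite le_eqVlt; apply/orP; left; apply/eqP; congr ((_%:R - _) ^+ 2).
apply: eq_card => x; rewrite !inE /r /=; congr (_ && _).
by rewrite sqnormB [LHS]eq_sym -subr_eq eq_sym; congr (_ == _); ring.
Qed.

Lemma card_parallel_le y x X : x \in X ->
  (#|[set x' in X | (x' == x) || (x' - y == - (x - y))%R]| <= 2)%N.
Proof.
move=> xX; apply: leq_trans (subset_leq_card _) (_ : #|[set x; (y - (x - y))%R]| <= 2)%N.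
  apply/subsetP => x'; rewrite !inE => /andP[_ /orP[->//|/eqP h]].
  by apply/orP; right; rewrite -h subrKC.
by rewrite cards2; case: eqP.
Qed.

(** * Hyperplanes and spheres attached to points of one sphere *)

Section Sphere.
Variables (t : F) (y : V) (X : {set V}).
Hypotheses (t0 : t != 0) (subX : {in X, forall x, sqnorm (x - y) = t}).

Let neq0 x : x \in X -> x - y != 0.
Proof. by move=> xX; apply: contraNneq t0 => xy; rewrite -(subX xX) xy sqnorm0. Qed.

(** The normals [x - y] all have norm [t], which is nonzero, so two of them are proportional only
    with factor 1 or -1: each [x] has at most two exceptional partners. *)
Lemma orthogonal_variance :
  \sum_w (#|[set x in X | dot (x - y) w == 0]|%:R - #|X|%:R / q%:R) ^+ 2
    <= 2 * #|X|%:R * q%:R ^+ d / q%:R :> R.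
Proof.
have := @second_moment_le R _ _ X (fun x w => dot (x - y) w == 0) q 2
  (fun x x' => (x' == x) || (x' - y == - (x - y))) cardF_gt0.
rewrite card_rV natrX; apply => [x xX|x x' xX x'X|x xX].
- exact: card_dot_eq (neq0 xX).
- rewrite negb_or => /andP[x'x x'Nx]; rewrite card_dot_eq2 ?neq0 // => c.
  apply/negP => /eqP h; have := subX x'X; rewrite h sqnormZ (subX xX).
  move/(canRL (mulfK t0)); rewrite divff // => /eqP; rewrite sqrf_eq1 => /orP[] /eqP c1.
    by move: x'x; rewrite -(inj_eq (addIr (- y))) h c1 scale1r eqxx.
  by move: x'Nx; rewrite h c1 scaleN1r eqxx.
- exact: card_parallel_le.
Qed.

(** Distinct proportional normals give disjoint affine hyperplanes here, so only the pairs with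
    [x = x'] are exceptional. *)
Lemma unit_variance :
  \sum_w (#|[set x in X | dot (x - y) w == 1]|%:R - #|X|%:R / q%:R) ^+ 2
    <= #|X|%:R * q%:R ^+ d / q%:R :> R.
Proof.
have := @second_moment_le R _ _ X (fun x w => dot (x - y) w == 1) q 1 eq_op cardF_gt0.
rewrite card_rV natrX mul1r; apply => [x xX|x x' xX x'X xx'|x xX].
- exact: card_dot_eq (neq0 xX).
- have [c xc|indep] := pickP (fun c => x' - y == c *: (x - y)); last first.
    by rewrite card_dot_eq2 ?neq0 // => c; rewrite indep.
  rewrite (_ : [set w | _] = set0) ?cards0 //; apply/setP => w; rewrite !inE.
  rewrite (eqP xc) dotZl; apply/negP => /andP[/eqP -> ]; rewrite mulr1 => /eqP c1.
  by move: xc xx'; rewrite c1 scale1r (inj_eq (addIr (- y))) eq_sym => ->.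
- exact: card_eq_le1.
Qed.

(* For [w] not isotropic, [sqnorm (x - y - w) = t] means [dot (x - y) w' = 1] for
   the inverse point [w' = (2 / sqnorm w) *: w]; otherwise it means
   [dot (x - y) w = 0]. *)
Lemma codegree_variance :
  \sum_z (#|[set x in X | sqnorm (x - z) == t]|%:R - #|X|%:R / q%:R) ^+ 2
    <= 3 * #|X|%:R * q%:R ^+ d / q%:R :> R.
Proof.
have -> : 3 * #|X|%:R * q%:R ^+ d / q%:R =
   2 * #|X|%:R * q%:R ^+ d / q%:R + #|X|%:R * q%:R ^+ d / q%:R :> R by ring.
rewrite (reindex_inj (@addrI _ y)) (bigID (fun w => sqnorm w == 0)) /=.
have adjE x w : x \in X -> (sqnorm (x - (y + w)) == t) = (2 * dot (x - y) w == sqnorm w).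
  move=> xX; rewrite opprD addrA sqnormB (subX xX) -subr_eq0 eq_sym -[RHS]subr_eq0 -[RHS]oppr_eq0.
  by rewrite eq_sym; congr (_ == _); ring.
apply: lerD.
  apply: le_trans orthogonal_variance; apply: le_trans (sum_sub_le (fun w => sqnorm w == 0) _).
    rewrite le_eqVlt; apply/orP; left; apply/eqP; apply: eq_bigr => w /eqP w0.
    congr ((_%:R - _) ^+ 2); apply: eq_card => x; rewrite !inE; apply: andb_id2l => xX.
    by rewrite adjE // w0 mulf_eq0 (negPf two_neq0).
  by move=> w; apply: sqr_ge0.
(* [phi] is an inversion: [sqnorm (phi w) = 4 / sqnorm w], so it is an involution on non-isotropic
   vectors and may be used to reindex. *)
pose phi w := (2 / sqnorm w) *: w.
have phiK : {in (fun w => sqnorm w != 0) &, injective phi}.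
  suff K : {in (fun w => sqnorm w != 0), cancel phi phi} by apply: can_in_inj K.
  move=> w; rewrite unfold_in => w0; rewrite /phi sqnormZ scalerA.
  rewrite -[RHS]scale1r; congr (_ *: _); field.
  by apply/andP; split=> //; rewrite (_ : 4 = 2 * 2 :> F) ?mulf_neq0 //; ring.
apply: le_trans unit_variance; apply: le_trans (sum_reindex_le phiK _).
  rewrite le_eqVlt; apply/orP; left; apply/eqP; apply: eq_bigr => w w0.
  congr ((_%:R - _) ^+ 2); apply: eq_card => x; rewrite !inE; apply: andb_id2l => xX.
  by rewrite adjE // dotZr mulrAC -[RHS](inj_eq (mulIf w0)) divfK // mul1r.
by move=> w; apply: sqr_ge0.
Qed.

End Sphere.
End Variance.

(** * Spheres in dimension three *)

(** Cauchy-Schwarz against the constant 1. *)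
Lemma sqr_sum_le (R : realFieldType) (I : finType) (A : {pred I}) (a : I -> R) :
  (\sum_(i in A) a i) ^+ 2 <= #|A|%:R * \sum_(i in A) a i ^+ 2.
Proof.
set S := \sum_(i in A) a i; have [A0|A0] := posnP #|A|.
  by rewrite /S big_pred0 ?expr0n ?A0 ?mul0r // => i; apply: card0_eq.
have N0 : 0 < #|A|%:R :> R by rewrite ltr0n.
have : 0 <= \sum_(i in A) (#|A|%:R * a i - S) ^+ 2 by apply: sumr_ge0 => i _; apply: sqr_ge0.
have -> : \sum_(i in A) (#|A|%:R * a i - S) ^+ 2 =
    #|A|%:R * (#|A|%:R * (\sum_(i in A) a i ^+ 2) - S ^+ 2).
  under eq_bigr => i _ do rewrite sqrrB exprMn -mulrnAl -mulrnAl -mulrA.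
  rewrite big_split sumrB /= -!mulr_sumr -mulr_suml sumr_const -/S; ring.
by rewrite pmulr_rge0 // subr_ge0.
Qed.

Section DimensionThree.
Variables (F : finFieldType) (R : realFieldType).
Hypothesis two_neq0 : 2 != 0 :> F.
Local Notation V := 'rV[F]_3.
Local Notation q := #|F|.
Local Notation i0 := (@ord0 2).
Local Notation i1 := (lift (@ord0 2) (@ord0 1)).
Local Notation i2 := (lift (@ord0 2) (lift (@ord0 1) (@ord0 0))).
Implicit Types (x y z u v w : V) (s t : F) (E : {set V}).

Lemma dot3E x y : dot x y = x 0 i0 * y 0 i0 + x 0 i1 * y 0 i1 + x 0 i2 * y 0 i2.
Proof. by rewrite /dot !big_ord_recl big_ord0 addr0 addrA. Qed.

Lemma ord3P (P : 'I_3 -> Prop) : P i0 -> P i1 -> P i2 -> forall i, P i.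
Proof.
move=> P0 P1 P2 [[|[|[|//]]] lt_i].
- by rewrite (_ : Ordinal _ = i0) //; apply: val_inj.
- by rewrite (_ : Ordinal _ = i1) //; apply: val_inj.
- by rewrite (_ : Ordinal _ = i2) //; apply: val_inj.
Qed.

(** A nondegenerate form in dimension 3 has no totally isotropic plane. Concretely, the three
    relations make the square of each 2 by 2 minor of [z] and [v] vanish. *)
Lemma isotropic_orthogonal_parallel v z : v != 0 -> sqnorm v = 0 ->
  sqnorm z = 0 -> dot z v = 0 -> exists c, z = c *: v.
Proof.
move=> /rV_neq0[i vi]; rewrite !sqnormE !dot3E => v0 z0 zv0.
have minor (a b c a' b' c' : F) : a * a + b * b + c * c = 0 ->
    a' * a' + b' * b' + c' * c' = 0 -> a' * a + b' * b + c' * c = 0 -> a' * b = b' * a.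
  move=> h h' hh; apply/eqP; rewrite -subr_eq0 -sqrf_eq0; apply/eqP.
  transitivity ((a * a + b * b + c * c) * (a' * a' + b' * b') - c * c * (a' * a' + b' * b' + c' * c')
    - (a' * a + b' * b + c' * c) * (a' * a + b' * b - c' * c)); first by ring.
  by rewrite h h' hh; ring.
have m01 := minor _ _ _ _ _ _ v0 z0 zv0.
have m02 : z 0 i0 * v 0 i2 = z 0 i2 * v 0 i0.
  by apply: (minor _ _ (v 0 i1) _ _ (z 0 i1)); rewrite addrAC.
have m12 : z 0 i1 * v 0 i2 = z 0 i2 * v 0 i1.
  by apply: (minor _ _ (v 0 i0) _ _ (z 0 i0)); rewrite addrC addrA.
have m : forall j k, z 0 j * v 0 k = z 0 k * v 0 j.
  by apply: ord3P; apply: ord3P; rewrite // ?m01 ?m02 ?m12.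
exists (z 0 i / v 0 i); apply/rowP => j; rewrite mxE mulrAC.
by apply: (mulIf vi); rewrite divfK // m.
Qed.

(** Let [n] be the cross product of [x] and [y]; its norm is the Gram determinant [g]. Orthogonality
    to [x] and [y] makes the cross product [c] of [n] and [u] vanish, Lagrange's identity with
    [sqnorm u = 0] then gives [n . u = 0], and expanding the cross product of [n] and [c] shows
    [g u = 0]. *)
Lemma isotropic_gram u x y : sqnorm u = 0 -> dot u x = 0 -> dot u y = 0 ->
  sqnorm x * sqnorm y - dot x y ^+ 2 != 0 -> u = 0.
Proof.
rewrite !sqnormE !dot3E => u0 ux uy gram.
set u1 := u 0 i0 in u0 ux uy *; set u2 := u 0 i1 in u0 ux uy *; set u3 := u 0 i2 in u0 ux uy *.
move: gram; set g := (X in X != 0) => gram.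
pose n1 := x 0 i1 * y 0 i2 - x 0 i2 * y 0 i1.
pose n2 := x 0 i2 * y 0 i0 - x 0 i0 * y 0 i2.
pose n3 := x 0 i0 * y 0 i1 - x 0 i1 * y 0 i0.
pose c1 := n2 * u3 - n3 * u2; pose c2 := n3 * u1 - n1 * u3; pose c3 := n1 * u2 - n2 * u1.
have [c1E c2E c3E] : [/\ c1 = 0, c2 = 0 & c3 = 0].
  split.
  - transitivity (y 0 i0 * (u1 * x 0 i0 + u2 * x 0 i1 + u3 * x 0 i2)
      - x 0 i0 * (u1 * y 0 i0 + u2 * y 0 i1 + u3 * y 0 i2)); last by rewrite ux uy; ring.
    by rewrite /c1 /n2 /n3; ring.
  - transitivity (y 0 i1 * (u1 * x 0 i0 + u2 * x 0 i1 + u3 * x 0 i2)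
      - x 0 i1 * (u1 * y 0 i0 + u2 * y 0 i1 + u3 * y 0 i2)); last by rewrite ux uy; ring.
    by rewrite /c2 /n1 /n3; ring.
  - transitivity (y 0 i2 * (u1 * x 0 i0 + u2 * x 0 i1 + u3 * x 0 i2)
      - x 0 i2 * (u1 * y 0 i0 + u2 * y 0 i1 + u3 * y 0 i2)); last by rewrite ux uy; ring.
    by rewrite /c3 /n1 /n2; ring.
have nu : n1 * u1 + n2 * u2 + n3 * u3 = 0.
  apply/eqP; rewrite -sqrf_eq0; apply/eqP.
  transitivity ((u1 * u1 + u2 * u2 + u3 * u3) * g - c1 ^+ 2 - c2 ^+ 2 - c3 ^+ 2).
    by rewrite /g /c1 /c2 /c3 /n1 /n2 /n3; ring.
  by rewrite u0 c1E c2E c3E; ring.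
apply/rowP; apply: ord3P; rewrite mxE; apply: (mulIf gram); rewrite mul0r.
- transitivity (n1 * (n1 * u1 + n2 * u2 + n3 * u3) - n2 * c3 + n3 * c2).
    by rewrite /g /c2 /c3 /n1 /n2 /n3 /u1 /u2 /u3; ring.
  by rewrite nu c2E c3E; ring.
- transitivity (n2 * (n1 * u1 + n2 * u2 + n3 * u3) - n3 * c1 + n1 * c3).
    by rewrite /g /c1 /c3 /n1 /n2 /n3 /u1 /u2 /u3; ring.
  by rewrite nu c1E c3E; ring.
- transitivity (n3 * (n1 * u1 + n2 * u2 + n3 * u3) - n1 * c2 + n2 * c1).
    by rewrite /g /c2 /c1 /n1 /n2 /n3 /u1 /u2 /u3; ring.
  by rewrite nu c2E c1E; ring.
Qed.

(** Otherwise the three obvious vectors orthogonal to [v = (a, b, c)], each with one zero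
    coordinate, are isotropic; then [a^2 + b^2], [a^2 + c^2] and [b^2 + c^2] vanish, which forces
    [v = 0] as 2 is invertible. *)
Lemma anisotropic_orthogonal v : v != 0 -> exists u, dot v u = 0 /\ sqnorm u != 0.
Proof.
move=> v0; pose a : F := v 0 i0; pose b : F := v 0 i1; pose c : F := v 0 i2.
pose e i : V := delta_mx 0 i.
have [/existsP[u]|] := boolP [exists u, (dot v u == 0) && (sqnorm u != 0)].
  by case/andP => /eqP ? ?; exists u.
move/existsPn => H; exfalso.
have iso w : dot v w = 0 -> sqnorm w = 0.
  by move=> vw; have := H w; rewrite vw eqxx /= negbK => /eqP.
have ab : a ^+ 2 + b ^+ 2 = 0.
  rewrite -(iso (b *: e i0 - a *: e i1)).
    by rewrite sqnormE dot3E !mxE /=; ring.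
  by rewrite dot3E !mxE /= -/a -/b; ring.
have ac : a ^+ 2 + c ^+ 2 = 0.
  rewrite -(iso (c *: e i0 - a *: e i2)).
    by rewrite sqnormE dot3E !mxE /=; ring.
  by rewrite dot3E !mxE /= -/a -/c; ring.
have bc : b ^+ 2 + c ^+ 2 = 0.
  rewrite -(iso (c *: e i1 - b *: e i2)).
    by rewrite sqnormE dot3E !mxE /=; ring.
  by rewrite dot3E !mxE /= -/b -/c; ring.
have sq0 (r : F) : 2 * r ^+ 2 = 0 -> r = 0.
  by move/eqP; rewrite mulf_eq0 (negPf two_neq0) sqrf_eq0 => /eqP.
have a0 : a = 0.
  apply: sq0; transitivity ((a ^+ 2 + b ^+ 2) + (a ^+ 2 + c ^+ 2) - (b ^+ 2 + c ^+ 2)); first by ring.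
  by rewrite ab ac bc; ring.
have b0 : b = 0 by move: ab; rewrite a0 expr0n /= add0r => /eqP; rewrite sqrf_eq0 => /eqP.
have c0 : c = 0 by move: ac; rewrite a0 expr0n /= add0r => /eqP; rewrite sqrf_eq0 => /eqP.
case/negP: v0; apply/eqP/rowP; apply: ord3P; rewrite mxE //.
Qed.

(* Every line in the direction [u] meets a sphere in at most two points. *)
Lemma card_quadric_le (A : {set V}) u s : sqnorm u != 0 ->
    (forall c z, z \in A -> z + c *: u \in A) ->
  (#|[set z in A | sqnorm z == s]| * q <= 2 * #|A|)%N.
Proof.
move=> u0 invA; set Z := [set z in A | _].
rewrite -cardsT -cardsX -sum1_card.
rewrite (partition_big (fun p : V * F => p.1 + p.2 *: u) (mem A)) /=; last first.
  by case=> z c; rewrite !inE => /andP[/andP[zA _] _]; apply: invA.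
rewrite mulnC -sum_nat_const; apply: leq_sum => p _.
rewrite sum1_card.
have [[z c]|E0] := pickP [pred i | (i \in setX Z [set: F]) && (i.1 + i.2 *: u == p)]; last first.
  by rewrite eq_card0.
rewrite !inE /= ?andbT => /andP[/andP[_ /eqP Qz] /eqP zc].
(* The parameter of the second intersection point: the other root of the quadratic along the
   line. *)
pose c' := c + 2 * dot z u / sqnorm u.
apply: leq_trans (_ : #|[set (z, c); ((p - c' *: u)%R, c')]| <= 2)%N; last first.
  by rewrite cards2; case: eqP.
apply/subset_leq_card/subsetP => -[z1 c1].
rewrite [in X in X -> _]unfold_in !inE /= andbT => /andP[/andP[_ /eqP Qz1] /eqP z1c].
have z1E : z1 = z + (c - c1) *: u by rewrite scalerBl addrA zc -z1c addrK.
move: Qz1; rewrite z1E sqnormD Qz dotZr sqnormZ => /eqP.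
rewrite -subr_eq0 (_ : _ - s = (c - c1) * (2 * dot z u + (c - c1) * sqnorm u)); last by ring.
rewrite mulf_eq0 => /orP[/eqP h|/eqP h].
  have -> : c1 = c by apply/eqP; rewrite eq_sym -subr_eq0 h.
  by rewrite subrr scale0r addr0 eqxx.
have -> : c1 = c'.
  apply/eqP; rewrite /c' -subr_eq0 -(mulIr_eq0 _ (mulIf u0)).
  by rewrite mulrBl mulrDl divfK // -oppr_eq0 -{}h; apply/eqP; ring.
by rewrite -zc scalerBl addrA eqxx orbT.
Qed.

Lemma q_gt2 : (2 < q)%N.
Proof.
have /card_uniqP card3 : uniq [:: 0; 1; -1 : F].
  rewrite /= !inE negb_or eq_sym oner_eq0 eq_sym oppr_eq0 oner_eq0 /=.
  by rewrite -addr_eq0 andbT.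
by rewrite -[3%N]/(size [:: 0; 1; -1 : F]) -card3 max_card.
Qed.

Lemma card_sphere_le s : (#|[set z : V | sqnorm z == s]| <= 2 * q ^ 2)%N.
Proof.
have u1 : sqnorm (delta_mx 0 i0 : V) != 0.
  by rewrite sqnormE dot_delta mxE !eqxx oner_eq0.
have := @card_quadric_le setT _ s u1 (fun _ _ _ => in_setT _).
rewrite cardsT card_rV expnS mulnCA [X in (_ <= X)%N]mulnC leq_pmul2r ?cardF_gt0 //.
by congr (_ <= _)%N; apply: eq_card => z; rewrite !inE.
Qed.

(** * Intersections of two spheres of equal radius *)

Definition sphere_pair s v := [set z : V | (sqnorm z == s) && (sqnorm (z - v) == s)].

Lemma sphere_pairE s v z : z \in sphere_pair s v -> sqnorm z = s /\ 2 * dot z v = sqnorm v.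
Proof.
rewrite inE sqnormB => /andP[/eqP-> /eqP h]; split=> //.
by apply/eqP; rewrite -subr_eq0 -oppr_eq0 -(subrr s) -{1}h; apply/eqP; ring.
Qed.

(** The intersection lies in the plane [2 dot z v = sqnorm v], which is ruled by lines in a
    non-isotropic direction, each meeting the sphere at most twice. *)
Lemma card_sphere_pair_le s v : v != 0 -> (#|sphere_pair s v| <= 2 * q)%N.
Proof.
move=> v0; have [u [vu u0]] := anisotropic_orthogonal v0.
pose A := [set z | dot v z == sqnorm v / 2].
have invA c z : z \in A -> z + c *: u \in A.
  by rewrite !inE !dotE vu mulr0 addr0.
have le1 := card_quadric_le s u0 invA.
have le2 : (#|sphere_pair s v| <= #|[set z in A | sqnorm z == s]|)%N.
  apply/subset_leq_card/subsetP => z /sphere_pairE[zs zv].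
  by rewrite !inE zs eqxx andbT dotC -zv mulrC mulKf.
have cardA : (#|A| * q = q ^ 2 * q)%N by rewrite card_dot_eq // expnSr.
have q0 := cardF_gt0 F; have cardA' : (#|A| = q ^ 2)%N by apply/eqP; rewrite -(eqn_pmul2r q0) cardA.
apply: (leq_trans le2); rewrite -(leq_pmul2r q0) (leq_trans le1) // cardA'.
by rewrite expnS expn1 mulnA.
Qed.

(** All points are isotropic and orthogonal to [v], hence on the line spanned by [v]. *)
Lemma card_sphere_pair_isotropic v : v != 0 -> sqnorm v = 0 ->
  (#|sphere_pair 0%R v| <= q)%N.
Proof.
move=> v0 Qv; apply: leq_trans (leq_imset_card (fun c : F => c *: v) predT).
apply/subset_leq_card/subsetP => z /sphere_pairE[z0]; rewrite Qv => /eqP.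
rewrite mulf_eq0 (negPf two_neq0) => /eqP zv.
by have [c ->] := isotropic_orthogonal_parallel v0 Qv z0 zv; apply: imset_f.
Qed.

(** The intersection is a nondegenerate conic, projected from one of its points [z0]. The chords
    [z - z0] are non-isotropic, and pairwise non-proportional; their nonzero multiples are distinct
    among the [q^2 - 1] nonzero vectors orthogonal to [v], so there are at most [q + 1] chords. *)
Lemma card_sphere_pair_generic s v : sqnorm v != 0 -> sqnorm v != 4 * s ->
  (#|sphere_pair s v| <= q + 2)%N.
Proof.
move=> Qv Qv4; have v0 : v != 0 by apply: contraNneq Qv => ->; rewrite sqnorm0.
have [->|[z0 z0P]] := set_0Vmem (sphere_pair s v); first by rewrite cards0.
have [z0s z0v] := sphere_pairE z0P.
rewrite (cardsD1 z0) z0P add1n addn2 ltnS.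
set Z := _ :\ z0.
have ZE z : z \in Z -> [/\ z - z0 != 0, dot (z - z0) v = 0 & sqnorm (z - z0) + 2 * dot (z - z0) z0 = 0].
  rewrite in_setD1 => /andP[zz0 /sphere_pairE[zs zv]]; split.
  - by rewrite subr_eq0.
  - by apply: (mulfI two_neq0); rewrite dotBl mulrBr zv z0v subrr mulr0.
  - rewrite sqnormB dotBl -[dot z0 z0]sqnormE zs z0s; ring.
have Qu z : z \in Z -> sqnorm (z - z0) != 0.
  case/ZE => u0 uv uz; apply: contraNneq u0 => Qu0; apply/eqP.
  apply: (isotropic_gram (x := z0) (y := v) Qu0 _ uv).
    by apply/eqP; move/eqP: uz; rewrite Qu0 add0r mulf_eq0 (negPf two_neq0).
  rewrite z0s; apply: contraNneq Qv4 => h.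
  (* Up to the factor 4 this is the Gram determinant of [z0] and [v]; both excluded values of
     [sqnorm v] are its zeros. *)
  have : sqnorm v * (4 * s - sqnorm v) = 4 * (s * sqnorm v - dot z0 v ^+ 2).
    rewrite -z0v; ring.
  by rewrite h mulr0 => /eqP; rewrite mulf_eq0 (negPf Qv) /= subr_eq0 eq_sym.
have inj : {in setX Z [set~ 0] &, injective (fun p : V * F => p.2 *: (p.1 - z0))}.
  move=> [z c] [z' c'] /=; rewrite !in_setX !in_setC1 /= => /andP[zZ c0] /andP[z'Z c'0] h.
  have [_ _ Hz] := ZE z zZ; have [_ _ Hz'] := ZE z' z'Z.
  pose r := c / c'.
  have z'E : z' - z0 = r *: (z - z0).
    by rewrite /r mulrC -scalerA h scalerA mulVf // scale1r.
  have r0 : r != 0 by rewrite mulf_neq0 ?invr_eq0.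
  have cE : c = r * c' by rewrite divfK.
  clearbody r; move: Hz'; rewrite z'E sqnormZ dotZl => Hz'.
  have : r * (r - 1) * sqnorm (z - z0) = 0.
    rewrite -[RHS]Hz' -[LHS]addr0 -(mulr0 r) -{1}Hz; ring.
  move/eqP; rewrite !mulf_eq0 (negPf r0) (negPf (Qu z zZ)) orbF /= subr_eq0 => /eqP r1.
  move: z'E; rewrite r1 scale1r => /addIr ->; congr (_, _).
  by rewrite cE r1 mul1r.
have img : (fun p : V * F => p.2 *: (p.1 - z0)) @: setX Z [set~ 0]
    \subset [set w | dot v w == 0] :\ 0.
  apply/subsetP => w /imsetP[[z c]]; rewrite in_setX in_setC1 /= => /andP[zZ c0] ->.
  have [u0 uv _] := ZE z zZ.
  by rewrite !inE scaler_eq0 (negPf c0) (negPf u0) dotZr dotC uv mulr0 eqxx.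
have := subset_leq_card img; rewrite card_in_imset // cardsX cardsC1.
have := cardsD1 0 [set w | dot v w == 0].
have := card_dot_eq 0 v0; rewrite inE dot0r eqxx add1n.
have := q_gt2; move: #|Z| #|_ :\ _| #|[set w | _]| (q) => a b c Q Q2.
move=> h1 h2 h3.
have cE : c = (Q ^ 2)%N.
  by apply/eqP; rewrite -(eqn_pmul2r (_ : 0 < Q)%N) ?h1 ?expnSr //; lia.
rewrite -(leq_pmul2r (_ : 0 < Q.-1)%N); last by lia.
by apply: (leq_trans h3); rewrite -ltnS -h2 cE expnS expn1; nia.
Qed.

(** Projection from a nonzero point [p] of the sphere: a vector [u] neither isotropic nor orthogonal
    to [p] is a multiple of [z - p] for the second point [z] of the sphere on the line through [p]
    along [u]. At most [3 q^2] vectors are left out, and each [z] accounts for at most [q]. *)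
Lemma card_sphere_ge s : (q ^ 2 <= #|[set z : V | sqnorm z == s]| + 3 * q)%N.
Proof.
set S := [set z | _].
have [p pS p0] : exists2 p, p \in S & p != 0.
  have [/existsP[p /andP[pS p0]]|/existsPn noP] := boolP [exists p, (p \in S) && (p != 0)].
    by exists p.
  have S1 : (#|S| <= 1)%N.
    apply: leq_trans (_ : #|[set 0%R : V]| <= 1)%N; last by rewrite cards1.
    apply/subset_leq_card/subsetP => p pS.
    by have := noP p; rewrite pS inE /= negbK.
  (* For the whole space every degree is [#|S| <= 1] while the mean is [q^2], which contradicts the
     variance bound for [q >= 3]. *)
  have := degree_variance rat two_neq0 [set: V] s.
  have cardS (y : V) : #|[set x in [set: V] | sqnorm (x - y) == s]| = #|S|.
    rewrite -(card_imset (mem S) (addIr y)); apply: eq_card => x; rewrite !inE /=.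
    apply/idP/imsetP => [h|[z zS ->]]; last by rewrite addrK; move: zS; rewrite inE.
    by exists (x - y); rewrite ?inE ?subrK.
  under eq_bigr => y _ do rewrite cardS.
  have Q3 : 3 <= q%:R :> rat by rewrite ler_nat q_gt2.
  have S1R : #|S|%:R <= 1 :> rat by rewrite lern1.
  rewrite sumr_const -[X in X <= _]mulr_natl [#|predT|]card_rV cardsT card_rV natrX.
  move: S1R Q3; set Q := q%:R; set n := #|S|%:R => n1 Q3.
  have -> : Q ^+ 3 / Q = Q ^+ 2 :> rat by field; apply: lt0r_neq0; lra.
  rewrite ler_pM2l ?exprn_gt0; [move=> h|lra..].
  have h1 : 0 <= (1 - n) * (2 * Q ^+ 2 - n - 1).
    by apply: mulr_ge0; [lra|have : 0 <= (Q - 3) * (Q + 3) by [apply: mulr_ge0; lra]; lra].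
  have h2 : 0 <= Q ^+ 2 * ((Q - 2) * (Q + 1)).
    by apply: mulr_ge0; [exact: sqr_ge0|apply: mulr_ge0; lra].
  by lra.
pose U := [set u : V | (sqnorm u != 0) && (dot p u != 0)].
have subU : U \subset (fun w : V * F => w.2 *: (w.1 - p)) @: setX S [set: F].
  apply/subsetP => u; rewrite inE => /andP[Qu pu].
  (* The reflection of [p] in the hyperplane orthogonal to [u], which has the same norm. *)
  apply/imsetP; exists (p - (2 * dot p u / sqnorm u) *: u, - sqnorm u / (2 * dot p u)) => /=.
    move: pS; rewrite !inE => /eqP pS; rewrite andbT sqnormB dotZr sqnormZ pS.
    apply/eqP; field; exact: Qu.
  rewrite addrAC subrr sub0r scalerN scalerA -[LHS]scale1r -scaleNr; congr (_ *: _).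
  by field; rewrite Qu pu two_neq0.
have le1 : (#|U| <= #|S| * q)%N.
  by rewrite -cardsT -cardsX (leq_trans (subset_leq_card subU)) // leq_imset_card.
have le2 : (q ^ 3 <= #|U| + 2 * q ^ 2 + q ^ 2)%N.
  have cov : [set: V] \subset U :|: [set z | sqnorm z == 0] :|: [set w | dot p w == 0].
    by apply/subsetP => u _; rewrite !inE; do 2!case: eqP.
  have := subset_leq_card cov; rewrite cardsT card_rV => /leq_trans; apply.
  rewrite (leq_trans (leq_card_setU _ _)) //; apply: leq_add.
    by rewrite (leq_trans (leq_card_setU _ _)) // leq_add2l card_sphere_le.
  by rewrite -(leq_pmul2r (cardF_gt0 F)) card_dot_eq // -expnSr.
move: le1 le2; have := cardF_gt0 F; move: #|U| #|S| (q) => a b Q Q0 h1 h2.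
rewrite -(leq_pmul2r Q0); apply: leq_trans (_ : (Q ^ 3 - Q ^ 2 * 0 <= _)%N).
  by rewrite muln0 subn0 -expnSr.
rewrite !expnS !expn0 in h2 *; nia.
Qed.

(** The conic is generic unless [sqnorm (x - x')] is 0 or [4 s]. For [s = 0] these values coincide
    and the isotropic bound [q] is already good enough, so the correction carries the factor
    [s != 0]; this is what later makes the radius 0 accessible first. *)
Lemma sphere_pair_bound s x x' :
  #|[set w : V | (sqnorm (x - w) == s) && (sqnorm (x' - w) == s)]|%:R
    <= (q + 2)%:R + (x == x')%:R * (2 * q ^ 2)%:R
     + (s != 0)%:R * (2 * q)%:R * ((sqnorm (x - x') == 0)%:R + (sqnorm (x - x') == 4 * s)%:R) :> R.
Proof.
set N := [set w | _]; have [->|xx'] := eqVneq x x'.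
  apply: (@le_trans _ _ (2 * q ^ 2)%:R); last first.
    by rewrite mul1r -addrAC lerDr addr_ge0 ?mulr_ge0 ?addr_ge0 ?ler0n.
  rewrite ler_nat; apply: leq_trans (card_sphere_le s).
  rewrite -(card_imset (mem [set z | sqnorm z == s]) (can_inj (subKr x'))).
  apply/subset_leq_card/subsetP => w; rewrite inE => /andP[_ ws].
  by apply/imsetP; exists (x' - w); rewrite /= ?inE ?subKr.
have v0 : x - x' != 0 by rewrite subr_eq0.
have -> : #|N| = #|sphere_pair s (x - x')|.
  have eN w : x - w - (x - x') = x' - w by rewrite opprB addrC addrA subrK.
  rewrite -(card_imset (mem (sphere_pair s (x - x'))) (can_inj (subKr x))).
  apply: eq_card => w; rewrite inE; apply/idP/imsetP => [wN|[z]].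
    by exists (x - w); rewrite /= ?inE ?eN ?subKr.
  by rewrite /= inE => zP ->; rewrite -eN !subKr.
rewrite mul0r addr0.
case: (eqVneq s 0) => [s0|s0] /=.
  rewrite !mul0r addr0 ler_nat.
  have [v1|v1] := eqVneq (sqnorm (x - x')) 0.
    by rewrite s0 (leq_trans (card_sphere_pair_isotropic v0 v1)) ?leq_addr.
  by rewrite card_sphere_pair_generic // s0 mulr0.
rewrite mul1r.
case: (boolP ((sqnorm (x - x') == 0) || (sqnorm (x - x') == 4 * s))) => [v1|].
  apply: (@le_trans _ _ (2 * q)%:R); first by rewrite ler_nat card_sphere_pair_le.
  rewrite ler_wpDl ?ler0n // ler_peMr ?ler0n //.
  by case/orP: v1 => ->; rewrite ?lerDl ?lerDr ler0n.
rewrite negb_or => /andP[v1 v2]; rewrite (negPf v1) (negPf v2) addr0 mulr0 addr0 ler_nat.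
exact: card_sphere_pair_generic.
Qed.

Definition pairs E s : R := \sum_(y in E) #|[set x in E | sqnorm (x - y) == s]|%:R.

(** Spheres have at least [q^2 - 3 q] points, so the main terms [n^2 q] cancel. The constant 8
    collects 2 from the conics of size [q + 2] and 6 from the defect [3 q]. *)
Lemma sphere_variance E s :
  \sum_y (#|[set x in E | sqnorm (x - y) == s]|%:R - #|E|%:R / q%:R) ^+ 2
    <= 8 * #|E|%:R ^+ 2 + 2 * q%:R ^+ 2 * #|E|%:R
       + (s != 0)%:R * (2 * q%:R) * (pairs E 0 + pairs E (4 * s)).
Proof.
set n := #|E|%:R; set Q := q%:R.
have Q0 : 0 < Q by rewrite ltr0n cardF_gt0.
have QN0 : Q != 0 by apply: lt0r_neq0.
pose S := #|[set z : V | sqnorm z == s]|.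
rewrite (second_moment E (fun x w => sqnorm (x - w) == s)) [#|predT|]card_rV natrX -/Q.
have -> : \sum_(x in E) #|[set w | sqnorm (x - w) == s]|%:R = n * S%:R.
  rewrite mulr_natl -sumr_const; apply: eq_bigr => x _; congr _%:R.
  rewrite /S -(card_imset (mem [set z | sqnorm z == s]) (can_inj (subKr x))).
  apply: eq_card => w; rewrite inE; apply/idP/imsetP => [ws|[z]].
    by exists (x - w); rewrite /= ?inE ?subKr.
  by rewrite /= inE => zs ->; rewrite subKr.
have h1 : \sum_(x in E) \sum_(x' in E)
   #|[set w : V | (sqnorm (x - w) == s) && (sqnorm (x' - w) == s)]|%:R
   <= n ^+ 2 * (Q + 2) + n * (2 * Q ^+ 2)
      + (s != 0)%:R * (2 * Q) * (pairs E 0 + pairs E (4 * s)).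
  apply: (le_trans (ler_sum _ (fun x _ => ler_sum _ (fun x' _ => sphere_pair_bound s x x')))).
  have pairsE r : \sum_(x in E) \sum_(x' in E) (sqnorm (x - x') == r)%:R = pairs E r.
    by rewrite exchange_big; apply: eq_bigr => x' _; rewrite natr_cardsE.
  have diagE : \sum_(x in E) \sum_(x' in E) (x == x')%:R = n :> R.
    rewrite /n natr_cardE [RHS]big_mkcond [LHS]big_mkcond /=; apply: eq_bigr => x _.
    case: ifP => // xE; rewrite (bigD1 x xE) /= eqxx big1 ?addr0 // => x' /andP[_].
    by rewrite eq_sym => /negPf->.
  set c := (s != 0)%:R * (2 * q)%:R.
  rewrite (eq_bigr (fun x => (Q + 2) * n + (\sum_(x' in E) (x == x')%:R) * (2 * Q ^+ 2) +
     c * (\sum_(x' in E) (sqnorm (x - x') == 0)%:R + \sum_(x' in E) (sqnorm (x - x') == 4 * s)%:R))).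
    rewrite big_split big_split sumr_const -mulr_suml -mulr_sumr big_split /= diagE !pairsE.
    by rewrite -[_ *+ _]mulr_natr -/n /c natrM -mulrA -expr2 [(Q + 2) * _]mulrC.
  move=> x _; rewrite big_split big_split sumr_const -mulr_suml -mulr_sumr big_split /= -[_ *+ _]mulr_natr.
  by rewrite natrD natrM natrX.
have h2 : Q ^+ 2 <= S%:R + 3 * Q.
  by rewrite /Q -natrM -natrX -natrD ler_nat card_sphere_ge.
have h3 : n * (n / Q) * Q ^+ 2 <= n * (n / Q) * (S%:R + 3 * Q).
  by rewrite ler_wpM2l // !mulr_ge0 ?invr_ge0 ?ler0n // ltW.
have e1 : n * (n / Q) * Q ^+ 2 = n ^+ 2 * Q by field.
have e2 : n * (n / Q) * (S%:R + 3 * Q) = n * (n / Q) * S%:R + 3 * n ^+ 2 by field.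
have e3 : (n / Q) ^+ 2 * Q ^+ 3 = n ^+ 2 * Q by field.
rewrite e3; rewrite e1 e2 in h3.
have -> : 2 * (n / Q) * (n * S%:R) = 2 * (n * (n / Q) * S%:R) by ring.
lra.
Qed.

Lemma pairs_deviation E s :
  (pairs E s - #|E|%:R ^+ 2 / q%:R) ^+ 2 <= #|E|%:R *
    (8 * #|E|%:R ^+ 2 + 2 * q%:R ^+ 2 * #|E|%:R
       + (s != 0)%:R * (2 * q%:R) * (pairs E 0 + pairs E (4 * s))).
Proof.
apply: le_trans (ler_wpM2l (ler0n _ _) (sphere_variance E s)).
have -> : pairs E s - #|E|%:R ^+ 2 / q%:R =
    \sum_(y in E) (#|[set x in E | sqnorm (x - y) == s]|%:R - #|E|%:R / q%:R).
  by rewrite sumrB sumr_const; congr (_ - _); apply: etrans (mulr_natr _ _); rewrite [RHS]mulrAC expr2.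
apply: (le_trans (sqr_sum_le _ _)); rewrite ler_wpM2l ?ler0n //.
by apply: sum_sub_le => y; apply: sqr_ge0.
Qed.

(** Write [a = n^2 / q]. The radius 0 has no correction term, so [pairs E 0 <= 2 a]. At a nonzero
    radius [m] with the most pairs, [pairs E (4 m) <= pairs E m] since [4 m != 0]; the deviation
    inequality then bounds [M] in terms of itself and gives [M <= 2 a]. The constant is
    [18 = 8 + 2 + 8]. *)
Lemma sphere_variance_large E t : t != 0 -> 100 * q%:R ^+ 2 <= #|E|%:R :> R ->
  \sum_y (#|[set x in E | sqnorm (x - y) == t]|%:R - #|E|%:R / q%:R) ^+ 2
    <= 18 * #|E|%:R ^+ 2 :> R.
Proof.
move=> t0 largeE; have := sphere_variance E t; rewrite t0 mul1r.
have := pairs_deviation E 0; rewrite eqxx mul0r mul0r addr0.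
have [/= m m0 maxm] := @arg_maxP _ _ _ t (fun s => s != 0) (pairs E) t0.
have four s : s != 0 -> 4 * s != 0.
  by move=> s0; rewrite (_ : 4 = 2 * 2 :> F) ?mulf_neq0 //; ring.
have := maxm _ (four _ t0); have := maxm _ (four _ m0).
have := pairs_deviation E m; rewrite m0 mul1r.
set V1 := \sum_y _; move: V1 => V1.
move: (pairs E 0) (pairs E m) (pairs E (4 * m)) (pairs E (4 * t)) => P0 M M4 Mt.
move: largeE; have : 0 < q%:R :> R by rewrite ltr0n cardF_gt0.
move: #|E|%:R q%:R => n Q Q0 nQ.
have Q2 : 0 < Q ^+ 2 by rewrite exprn_gt0.
have n0 : 0 < n by lra.
pose a := n ^+ 2 / Q; have aE : a * Q = n ^+ 2 by rewrite divfK // lt0r_neq0.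
rewrite -/a; clearbody a.
have a0 : 0 < a by rewrite -(pmulr_lgt0 _ Q0) aE exprn_gt0.
have h1 : 100 * (n * Q) <= a.
  rewrite -(ler_pM2r Q0) aE -[100 * _ * _]mulrA -[n * Q * Q]mulrA -expr2 mulrCA expr2.
  by rewrite ler_pM2l.
have h2 : 100 * n ^+ 3 <= a ^+ 2.
  rewrite -(ler_pM2r Q2) -exprMn aE (_ : _ * Q ^+ 2 = n ^+ 3 * (100 * Q ^+ 2)); last by ring.
  by rewrite (_ : (n ^+ 2) ^+ 2 = n ^+ 3 * n) ?ler_pM2l ?exprn_gt0 //; ring.
have h3 : n * (Q ^+ 2 * n) <= n * (n * n).
  by rewrite !ler_pM2l ?ler_pM2r //; lra.
have h8 : 0 < a * a by apply: mulr_gt0.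
move=> dM M4M MtM dP0 V1le.
have P0a : P0 <= 2 * a.
  rewrite leNgt; apply/negP => h.
  have : 0 < (P0 - 2 * a) * P0 by apply: mulr_gt0; lra.
  by have : n * (8 * n ^+ 2 + 2 * Q ^+ 2 * n) <= 10 * n ^+ 3 by [lra]; lra.
have Ma : M <= 2 * a.
  rewrite leNgt; apply/negP => h.
  have h4 : 0 <= (M - 2 * a) ^+ 2 by apply: sqr_ge0.
  have h5 : n * (2 * Q * (P0 + M4)) <= 2 * (n * Q) * (2 * a + M).
    rewrite (_ : n * _ = 2 * (n * Q) * (P0 + M4)); last by ring.
    by rewrite ler_wpM2l ?mulr_ge0 //; lra.
  have h6 : 100 * (n * Q) * (2 * a + M) <= a * (2 * a + M).
    by rewrite ler_wpM2r //; lra.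
  have h7 : 0 < a * (M - 2 * a) by apply: mulr_gt0; lra.
  have : n * (8 * n ^+ 2 + 2 * Q ^+ 2 * n + 2 * Q * (P0 + M4)) <= 10 * n ^+ 3 + n * (2 * Q * (P0 + M4)) by lra.
  lra.
apply: (le_trans V1le).
have : 2 * Q * (P0 + Mt) <= 2 * Q * (4 * a) by rewrite ler_wpM2l //; lra.
have : 2 * Q * (4 * a) = 8 * n ^+ 2 by rewrite -aE; ring.
have : Q ^+ 2 * n <= n * n by rewrite ler_pM2r //; lra.
lra.
Qed.

End DimensionThree.

(** * Random tuples of neighbours *)

Lemma card_family_prod (I T : finType) (A : I -> {pred T}) :
  #|family A| = (\prod_i #|A i|)%N.
Proof. by rewrite card_family foldrE big_image. Qed.

Lemma prod_if_const (I : finType) (S : {set I}) (a b : nat) :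
  (\prod_i (if i \in S then a else b) = a ^ #|S| * b ^ (#|I| - #|S|))%N.
Proof.
rewrite (bigID (mem S)) /=; congr (_ * _)%N.
  by rewrite -prod_nat_const; apply: eq_bigr => i ->.
rewrite -[S in RHS]setCK -cardsCs -prod_nat_const; apply: eq_big => [i|i /negPf-> //].
by rewrite inE.
Qed.

Section RandomTuples.
Variables (R : realFieldType) (V : finType) (adj : rel V) (k : nat).
Variables (E Y : {set V}) (N : V -> {set V}) (D : nat).
Hypothesis cardN : {in Y, forall y, #|N y| = D}.
Hypothesis subN : {in Y, forall y x, x \in N y -> (x \in E) && adj x y}.
Hypothesis subY : Y \subset E.
Implicit Types (S : {set 'I_k}) (x g : {ffun 'I_k -> V}) (p : V -> {ffun 'I_k -> V} -> bool).

Definition common x S := [set z in E | [forall i in S, adj (x i) z]].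

Definition tuples y := [set x : {ffun 'I_k -> V} | [forall i, x i \in N y]].

(** Divided by [#|Y| D^k], this is the probability of [p] for a uniform centre and a uniform tuple
    of its neighbours. *)
Definition bad_count p : nat := (\sum_(y in Y) #|[set x in tuples y | p y x]|)%N.

Lemma commonP x S z :
  reflect (z \in E /\ forall i, i \in S -> adj (x i) z) (z \in common x S).
Proof.
rewrite inE; apply: (iffP andP) => -[zE].
  by move/forall_inP.
by split=> //; apply/forall_inP.
Qed.

Lemma card_tuples y : y \in Y -> #|tuples y| = (D ^ k)%N.
Proof.
move=> yY; rewrite -(cardN yY) -[X in (_ ^ X)%N]card_ord -card_ffun_on.
apply: eq_card => x; rewrite inE.
by apply/forallP/ffun_onP.
Qed.

Lemma common_center y x S : y \in Y -> x \in tuples y -> y \in common x S.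
Proof.
move=> yY; rewrite inE => /forallP xN; apply/commonP; split.
  exact: (subsetP subY).
by move=> i _; have /andP[] := subN yY (xN i).
Qed.

(* Double counting: given the restriction [g] of the tuple to [S], its centre is
   one of the less than [c] common neighbours of [g]. *)
Lemma bad_count_small_common S (c : R) : 0 <= c ->
  (bad_count (fun _ x => #|common x S|%:R < c))%:R
    <= #|E|%:R ^+ #|S| * D%:R ^+ (k - #|S|) * c.
Proof.
move=> c0; have [Y0|[v0 v0Y]] := set_0Vmem Y.
  by rewrite /bad_count Y0 big_set0 !mulr_ge0 ?exprn_ge0 ?ler0n.
(* The default [v0] outside [S] makes the restrictions functions supported on [S], of which there
   are at most [#|E|^#|S|]. *)
pose res x := [ffun i => if i \in S then x i else v0].
have common_res x : common (res x) S = common x S.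
  apply/setP => z; apply/commonP/commonP => -[zE h]; split=> // i iS.
    by have := h i iS; rewrite ffunE iS.
  by rewrite ffunE iS; apply: h.
pose G := [set g : {ffun 'I_k -> V} | (g \in pffun_on v0 (mem S) (mem E)) && (#|common g S|%:R < c)].
have cardG : (#|G| <= #|E| ^ #|S|)%N.
  rewrite -(card_pffun_on v0 (mem S) (mem E)); apply/subset_leq_card/subsetP => g.
  by rewrite inE => /andP[].
have fiber y : y \in Y ->
    (#|[set x in tuples y | (#|common x S|%:R < c)%R]| <=
       \sum_(g in G | y \in common g S) D ^ (k - #|S|))%N.
  move=> yY; rewrite -sum1_card (partition_big (res : {ffun _ -> _} -> {ffun _ -> _}) [pred g | (g \in G) && (y \in common g S)]) /=.
    apply: leq_sum => g _; rewrite sum1_card.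
    pose B i := if i \in S then pred1 (g i) else mem (N y).
    apply: leq_trans (_ : #|family (B : 'I_k -> {pred V})| <= _)%N.
      apply/subset_leq_card/subsetP => x; rewrite unfold_in !inE => /andP[/andP[xN _] /eqP xg].
      apply/familyP => i; rewrite /B; case: ifP => iS; last exact: (forallP xN).
      by rewrite inE -xg ffunE iS.
    rewrite card_family_prod; under eq_bigr => i _.
      rewrite (_ : #|_| = if i \in S then 1%N else D); first over.
      by rewrite /B; case: ifP; rewrite ?card1 ?cardN.
    by rewrite prod_if_const exp1n mul1n card_ord.
  move=> x; rewrite inE => /andP[xN xc].
  have yC := common_center S yY xN.
  rewrite inE /=; apply/andP; split; last by rewrite common_res.
  rewrite inE; apply/andP; split; last by rewrite common_res.
  apply/pffun_onP; split.
    by apply/supportP => i /negPf iS; rewrite ffunE [i \in S]iS.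
  move=> _ /imageP[i iS ->]; rewrite ffunE [i \in S]iS.
  move: xN; rewrite inE => /forallP xN; by have /andP[] := subN yY (xN i).
rewrite /bad_count.
apply: (@le_trans _ _ (\sum_(g in G) \sum_(y in common g S) D%:R ^+ (k - #|S|))).
  apply: (@le_trans _ _ (\sum_(y in Y) \sum_(g in G | y \in common g S) D ^ (k - #|S|))%N%:R).
    by rewrite ler_nat; apply: leq_sum.
  rewrite natr_sum; under eq_bigr => y _ do rewrite natr_sum.
  rewrite (exchange_big_dep (mem G)) /=; last by move=> y g _ /andP[].
  apply: ler_sum => g gG; under eq_bigr => y _ do rewrite natrX.
  rewrite big_mkcond [X in _ <= X]big_mkcond; apply: ler_sum => y _.
  case: ifP => [/andP[_ /andP[_ ->]]//|_]; by case: ifP => // _; rewrite exprn_ge0.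
under eq_bigr => g gG do rewrite sumr_const.
apply: (@le_trans _ _ (\sum_(g in G) c * D%:R ^+ (k - #|S|))).
  apply: ler_sum => g; rewrite inE => /andP[_ /ltW gc].
  by rewrite -[_ *+ _]mulr_natl ler_wpM2r ?exprn_ge0.
rewrite sumr_const -[_ *+ _]mulr_natl mulrA [X in _ <= X]mulrAC ler_wpM2r ?exprn_ge0 //.
by rewrite ler_wpM2r // -natrX ler_nat.
Qed.

(** Counting the pairs [(x, z)] by [z]: coordinates in [S] range over the common neighbours of [y]
    and [z] in [N y], the others over all of [N y]. *)
Lemma sum_common y S : y \in Y ->
  (\sum_(x in tuples y) #|common x S| =
   (\sum_(z in E) #|[set x in N y | adj x z]| ^ #|S|) * D ^ (k - #|S|))%N.
Proof.
move=> yY; under eq_bigr => x _.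
  rewrite -sum1_card (eq_bigl (fun z => (z \in E) && [forall i in S, adj (x i) z])); last first.
    by move=> z; rewrite inE.
  over.
rewrite (exchange_big_dep (mem E)) /=; last by move=> x z _ /andP[].
rewrite big_distrl; apply: eq_bigr => z zE /=; rewrite sum1_card.
pose B i := if i \in S then mem [set x in N y | adj x z] else mem (N y).
have -> : (D ^ (k - #|S|) = D ^ (#|'I_k| - #|S|))%N by rewrite card_ord.
rewrite -prod_if_const.
have -> : (\prod_(i : 'I_k) (if i \in S then #|[set x in N y | adj x z]| else D) =
    \prod_i #|(B i : {pred V})|)%N.
  by apply: eq_bigr => i _; rewrite /B; case: ifP; rewrite ?cardN.
rewrite -card_family_prod; apply: eq_card => x.
rewrite unfold_in zE inE /=; apply/andP/familyP => [[/forallP xN /forall_inP xz] i|h].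
  by rewrite /B; case: ifP => iS; rewrite ?inE xN // xz.
split; first by apply/forallP => i; have := h i; rewrite /B; case: ifP; rewrite ?inE => // _ /andP[].
by apply/forall_inP => i iS; have := h i; rewrite /B iS inE => /andP[].
Qed.

(** Markov's inequality for the expectation computed in [sum_common]. *)
Lemma bad_count_large_common S (c : R) :
  (bad_count (fun _ x => c < #|common x S|%:R))%:R * c
    <= \sum_(y in Y) (\sum_(z in E) #|[set x in N y | adj x z]|%:R ^+ #|S|) * D%:R ^+ (k - #|S|).
Proof.
rewrite natr_sum mulr_suml; apply: ler_sum => y yY.
have -> : (\sum_(z in E) #|[set x in N y | adj x z]|%:R ^+ #|S|) * D%:R ^+ (k - #|S|) =
    \sum_(x in tuples y) #|common x S|%:R :> R.
  rewrite -natr_sum sum_common // natrM natrX natr_sum; congr (_ * _).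
  by apply: eq_bigr => z _; rewrite natrX.
rewrite natr_cardsE mulr_suml; apply: ler_sum => x _.
by case: ltP => [/ltW|_]; rewrite ?mul1r ?mul0r ?ler0n.
Qed.

(** A union bound over the bad events. *)
Lemma exists_good_tuple (I : finType) (p : I -> V -> {ffun 'I_k -> V} -> bool) (delta : R) :
    (forall i, (bad_count (p i))%:R <= delta * (#|Y|%:R * D%:R ^+ k)) ->
    #|I|%:R * delta < 1 -> (0 < #|Y|)%N -> (0 < D)%N ->
  exists y x, [/\ y \in Y, x \in tuples y & forall i, ~~ p i y x].
Proof.
move=> bad delta1 Y0 D0.
have [/existsP[y /existsP[x /and3P[yY xy /forallP h]]]|] :=
    boolP [exists y, [exists x, [&& y \in Y, x \in tuples y & [forall i, ~~ p i y x]]]].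
  by exists y, x.
move=> /existsPn H; exfalso.
have tot : #|Y|%:R * D%:R ^+ k <= \sum_i (bad_count (p i))%:R :> R.
  have -> : \sum_i (bad_count (p i))%:R =
      \sum_(y in Y) \sum_i #|[set x in tuples y | p i y x]|%:R :> R.
    by rewrite exchange_big; apply: eq_bigr => i _; rewrite natr_sum.
  rewrite mulr_natl -sumr_const; apply: ler_sum => y yY.
  rewrite -natrX -(card_tuples yY) -sum1_card natr_sum.
  under [X in _ <= X]eq_bigr => i _ do rewrite natr_cardsE.
  rewrite exchange_big; apply: ler_sum => x xy /=.
  have /existsPn/(_ x) := H y; rewrite yY xy /= negb_forall => /existsP[i].
  rewrite negbK (bigD1 i) //= => ->; rewrite lerDl sumr_ge0 // => j _; exact: ler0n.
have : 0 < #|Y|%:R * D%:R ^+ k :> R by rewrite mulr_gt0 ?exprn_gt0 ?ltr0n.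
move: tot bad; move: (#|Y|%:R * D%:R ^+ k) => total tot bad total_gt0.
have := le_trans tot (ler_sum _ (fun i _ => bad i)).
rewrite sumr_const -mulr_natl => le_total.
have : #|I|%:R * delta * total < 1 * total by rewrite ltr_pM2r.
by lra.
Qed.

End RandomTuples.

(** * Moments of codegrees *)

(** Chebyshev: a point of [E] outside the set has degree below [n / 2q], half the mean, and
    contributes at least [(n / 2q)^2] to the variance; hence there are at most [n / 2] such
    points. *)
Lemma regular_degree (R : realFieldType) (F : finFieldType) (d : nat) (t : F)
    (E : {set 'rV[F]_d}) (S : R) :
    \sum_y (#|[set x in E | sqnorm (x - y) == t]|%:R - #|E|%:R / #|F|%:R) ^+ 2 <= S ->
    8 * #|F|%:R ^+ 2 * S <= #|E|%:R ^+ 3 ->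
  #|E|%:R <= 2 * #|[set y in E | #|E| <= 2 * #|F| * #|[set x in E | sqnorm (x - y) == t]|]%N|%:R :> R.
Proof.
set deg := fun y => #|[set x in E | sqnorm (x - y) == t]|.
set Y := [set y in E | _]; set n := #|E|%:R; set q := #|F|%:R => varS leS.
have q0 : 0 < q by rewrite ltr0n cardF_gt0.
have [E0|E0] := posnP #|E|; first by rewrite /n E0 mulr_ge0 ?ler0n.
have n0 : 0 < n by rewrite ltr0n.
have YE : Y \subset E by apply/subsetP => y; rewrite inE => /andP[].
have cardE : n = #|Y|%:R + #|E :\: Y|%:R.
  by rewrite /n -natrD -(cardsID Y E) (setIidPr YE).
have h : #|E :\: Y|%:R * (n / (2 * q)) ^+ 2 <= S.
  apply: le_trans varS; apply: le_trans (sum_sub_le (mem (E :\: Y)) _); last first.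
    by move=> y; apply: sqr_ge0.
  rewrite mulr_natl -sumr_const; apply: ler_sum => y; rewrite !inE => /andP[+ yE].
  rewrite yE /= -ltnNge -(ltr_nat R) !natrM -/q => small.
  have small' : (deg y)%:R < n / (2 * q) by rewrite ltr_pdivlMr ?mulr_gt0 // mulrC.
  have -> : n / q = n / (2 * q) + n / (2 * q) by field; exact: lt0r_neq0.
  have : 0 <= (deg y)%:R :> R by rewrite ler0n.
  move: small'; rewrite /deg; move: (n / _) (_%:R) => a b; nra.
have h' : #|E :\: Y|%:R * n ^+ 2 <= 4 * q ^+ 2 * S.
  have -> : #|E :\: Y|%:R * n ^+ 2 = 4 * q ^+ 2 * (#|E :\: Y|%:R * (n / (2 * q)) ^+ 2).
    by field; exact: lt0r_neq0.
  by rewrite ler_wpM2l // mulr_ge0 // exprn_ge0 // ltW.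
have : n ^+ 2 * (2 * #|E :\: Y|%:R) <= n ^+ 2 * n by lra.
by rewrite ler_pM2l ?exprn_gt0 //; lra.
Qed.

Section Moments.
Variables (F : finFieldType) (d : nat) (R : realFieldType).
Hypothesis two_neq0 : 2 != 0 :> F.
Local Notation V := 'rV[F]_d.
Local Notation q := #|F|.
Implicit Types (x y z w : V).
Variables (t : F) (y0 : V) (X E : {set V}).
Hypotheses (t0 : t != 0) (subX : {in X, forall x, sqnorm (x - y0) = t}).
Hypotheses (X_gt0 : (0 < #|X|)%N) (E_gt0 : (0 < #|E|)%N) (largeX : (#|E| <= 2 * q * #|X|)%N).

Let codeg z := #|[set x in X | sqnorm (x - z) == t]|.

Let q0 : 0 < q%:R :> R. Proof. by rewrite ltr0n cardF_gt0. Qed.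
Let X0 : 0 < #|X|%:R :> R. Proof. by rewrite ltr0n. Qed.
Let n0 : 0 < #|E|%:R :> R. Proof. by rewrite ltr0n. Qed.

(** [largeX] trades a factor [#|E|] for [2 q #|X|], which makes the variance term homogeneous of
    degree [m] in [#|X|] like the main term. *)
Lemma codegree_moment (m : nat) : (2 <= m)%N ->
  \sum_(z in E) (codeg z)%:R ^+ m <=
    #|X|%:R ^+ m * (2 ^+ m * (#|E|%:R / q%:R ^+ m + 6 * q%:R ^+ d / #|E|%:R)) :> R.
Proof.
move=> m2; set D := #|X|%:R; set n := #|E|%:R; set Q := q%:R.
have cD z : (0 : R) <= (codeg z)%:R <= D.
  by rewrite ler0n ler_nat subset_leq_card //; apply/subsetP => x; rewrite inE => /andP[].
have mu0 : 0 <= D / Q by rewrite divr_ge0 ?ler0n.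
apply: (le_trans (sum_pow_le (mem E) m2 mu0 (ltW X0) cD (codegree_variance R two_neq0 t0 subX))).
rewrite -/D -/Q -/n [X in _ <= X]mulrCA ler_wpM2l ?exprn_ge0 // mulrDr; apply: lerD.
  by rewrite exprMn exprVn mulrCA.
have -> : D ^+ m = D ^+ (m - 2) * D ^+ 2 by rewrite -exprD subnK.
rewrite -[X in _ <= X]mulrA ler_wpM2l ?exprn_ge0 ?(ltW X0) //.
have nD : n <= 2 * Q * D by rewrite -!natrM ler_nat.
have e1 : 3 * D * Q ^+ d / Q = (D * Q ^+ d / (Q * n)) * (3 * n) by field; rewrite !lt0r_neq0.
have e2 : D ^+ 2 * (6 * Q ^+ d / n) = (D * Q ^+ d / (Q * n)) * (3 * (2 * Q * D)) by field; rewrite !lt0r_neq0.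
rewrite e1 e2; apply: ler_wpM2l; last by rewrite ler_wpM2l.
by rewrite divr_ge0 ?mulr_ge0 ?exprn_ge0 // ltW.
Qed.

(** The first moment is reached through the second by [b <= a + b^2 / a] with [a = eta #|X|]. *)
Lemma codegree_sum (eta : R) : 0 < eta ->
  \sum_(z in E) (codeg z)%:R <=
    #|X|%:R * (eta * #|E|%:R + 4 / eta * (#|E|%:R / q%:R ^+ 2 + 6 * q%:R ^+ d / #|E|%:R)).
Proof.
move=> eta0; have h := @codegree_moment 2 isT; set D := #|X|%:R in h *.
have eD : 0 < eta * D by rewrite mulr_gt0.
apply: (@le_trans _ _ (\sum_(z in E) (eta * D + (eta * D)^-1 * (codeg z)%:R ^+ 2))).
  apply: ler_sum => z _; rewrite -(ler_pM2l eD) mulrDr mulVKf ?lt0r_neq0 //.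
  move: (eta * D) ((codeg z)%:R) => a b; nra.
rewrite big_split /= sumr_const -mulr_sumr mulrDr; apply: lerD.
  by rewrite -[X in X <= _]mulr_natr mulrCA mulrA.
rewrite mulrC ler_pdivrMr //; apply: (le_trans h).
move: (_ + _) => u; rewrite le_eqVlt; apply/orP; left; apply/eqP.
by field; rewrite lt0r_neq0.
Qed.

Lemma hyperplane_moment (m : nat) : (2 <= m)%N ->
  \sum_w #|[set x in X | dot (x - y0) w == 0]|%:R ^+ m <=
    #|X|%:R ^+ m * (2 ^+ m * (q%:R ^+ d / q%:R ^+ m + 4 * q%:R ^+ d / #|E|%:R)) :> R.
Proof.
move=> m2; set D := #|X|%:R; set n := #|E|%:R; set Q := q%:R.
have cD w : (0 : R) <= #|[set x in X | dot (x - y0) w == 0]|%:R <= D.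
  by rewrite ler0n ler_nat subset_leq_card //; apply/subsetP => x; rewrite inE => /andP[].
have mu0 : 0 <= D / Q by rewrite divr_ge0 ?ler0n.
apply: (le_trans (sum_pow_le predT m2 mu0 (ltW X0) cD (orthogonal_variance R t0 subX))).
rewrite [#|predT|]card_rV natrX -/D -/Q [X in _ <= X]mulrCA ler_wpM2l ?exprn_ge0 // mulrDr; apply: lerD.
  by rewrite exprMn exprVn mulrCA.
have -> : D ^+ m = D ^+ (m - 2) * D ^+ 2 by rewrite -exprD subnK.
rewrite -[X in _ <= X]mulrA ler_wpM2l ?exprn_ge0 ?(ltW X0) //.
have nD : n <= 2 * Q * D by rewrite -!natrM ler_nat.
have e1 : 2 * D * Q ^+ d / Q = (D * Q ^+ d / (Q * n)) * (2 * n) by field; rewrite !lt0r_neq0.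
have e2 : D ^+ 2 * (4 * Q ^+ d / n) = (D * Q ^+ d / (Q * n)) * (2 * (2 * Q * D)) by field; rewrite !lt0r_neq0.
rewrite e1 e2; apply: ler_wpM2l; last by rewrite ler_wpM2l.
by rewrite divr_ge0 ?mulr_ge0 ?exprn_ge0 // ltW.
Qed.

End Moments.

(** * Rare events *)

Section Independence.
Variables (F : finFieldType) (d k : nat) (t : F).
Hypothesis two_neq0 : 2 != 0 :> F.
Local Notation V := 'rV[F]_d.
Local Notation q := #|F|.
Implicit Types (x : {ffun 'I_k -> V}) (y z w v : V) (E Y : {set V}).

Definition at_distance : rel V := fun v z => sqnorm (v - z) == t.

(** For [k = d] this is linear dependence of the vectors [x i - y], stated dually. *)
Definition dependent_at y x := [exists w, (w != 0) && [forall i, dot (x i - y) w == 0]].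

(** With [y] as origin, a common neighbour [u] solves the linear system
    [2 dot (x i - y) u = sqnorm u]. Nonzero solutions are non-isotropic and, by independence,
    proportional to each other with ratio that of their norms; comparing norms shows that they
    coincide. So there is at most one besides [y]. *)
Lemma card_common_independent E y x : (forall i, at_distance (x i) y) ->
  ~~ dependent_at y x -> (#|common at_distance E x setT| <= 2)%N.
Proof.
move=> xy indep.
have indepP w : (forall i, dot (x i - y) w = 0) -> w = 0.
  move=> h; apply/eqP; apply: contraR indep => w0; apply/existsP; exists w.
  by rewrite w0; apply/forallP => i; rewrite h.
have commonE z : z \in common at_distance E x setT ->
    forall i, 2 * dot (x i - y) (z - y) = sqnorm (z - y).
  move=> /commonP[_ h] i; have /eqP := h i (in_setT i).
  rewrite (_ : x i - z = (x i - y) - (z - y)); last by rewrite opprB addrA subrK.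
  rewrite sqnormB (eqP (xy i)) -[X in _ = X]addr0 -addrA => /addrI /eqP.
  by rewrite addrC subr_eq0 => /eqP.
have norm_neq0 z : z \in common at_distance E x setT -> z != y -> sqnorm (z - y) != 0.
  move=> zC zy; apply: contraNneq zy => z0; rewrite -subr_eq0; apply/eqP/indepP => i.
  by apply: (mulfI two_neq0); rewrite commonE // z0 mulr0.
have [/existsP[z1 /andP[z1C z1y]]|] :=
    boolP [exists z, (z \in common at_distance E x setT) && (z != y)]; last first.
  move/existsPn => only; apply: leq_trans (_ : #|[set y]| <= 2)%N; last by rewrite cards1.
  apply/subset_leq_card/subsetP => z zC; have := only z; rewrite zC /= negbK inE => //.
apply: leq_trans (_ : #|[set y; z1]| <= 2)%N; last by rewrite cards2; case: eqP.
apply/subset_leq_card/subsetP => z zC; rewrite !inE; case: eqVneq => //= zy.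
have a0 := norm_neq0 _ zC zy; have b0 := norm_neq0 _ z1C z1y.
move: (commonE _ zC) (commonE _ z1C) a0 b0.
rewrite -(inj_eq (addIr (- y))); move: (z - y) (z1 - y) => u v hu hv a0 b0.
have /eqP : sqnorm v *: u - sqnorm u *: v = 0.
  apply: indepP => i; apply: (mulfI two_neq0).
  by rewrite dotBr !dotZr mulr0 mulrBr !(mulrCA 2) hu hv mulrC subrr.
rewrite subr_eq0 => /eqP uv.
have := congr1 (@sqnorm F d) uv; rewrite !sqnormZ => normE.
have : sqnorm u * sqnorm v * (sqnorm v - sqnorm u) = 0.
  transitivity (sqnorm v ^+ 2 * sqnorm u - sqnorm u ^+ 2 * sqnorm v); first by ring.
  by rewrite normE subrr.
move/eqP; rewrite !mulf_eq0 (negPf a0) (negPf b0) /= subr_eq0 => /eqP vu.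
by move/eqP: uv; rewrite vu -subr_eq0 -scalerBr scaler_eq0 (negPf a0) subr_eq0.
Qed.

(** The right side counts pairs of a tuple and a vector [w] orthogonal to it; a dependent tuple is
    orthogonal to a whole line of [q] vectors. *)
Lemma card_dependent_le (N : V -> {set V}) y :
  (q * #|[set x in tuples k N y | dependent_at y x]|
    <= \sum_w #|[set v in N y | (dot (v - y) w == 0)%R]| ^ k)%N.
Proof.
pose orth w x := [forall i, dot (x i - y) w == 0].
have -> : (\sum_w #|[set v in N y | (dot (v - y) w == 0)%R]| ^ k =
    \sum_(x in tuples k N y) #|[set w | orth w x]|)%N.
  under [RHS]eq_bigr => x _ do rewrite -sum1_card.
  rewrite (exchange_big_dep predT) //=; apply: eq_bigr => w _.
  rewrite sum1_card; have -> : (#|[set v in N y | (dot (v - y) w == 0)%R]| ^ k =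
      #|[set v in N y | (dot (v - y) w == 0)%R]| ^ #|'I_k|)%N by rewrite card_ord.
  rewrite -card_ffun_on; apply: eq_card => x; rewrite [RHS]unfold_in !inE.
  apply/ffun_onP/andP => [h|[/forallP xN /forallP xw] i]; last by rewrite inE xN xw.
  by split; apply/forallP => i; have := h i; rewrite inE => /andP[].
rewrite mulnC -sum_nat_const big_mkcond [X in (_ <= X)%N]big_mkcond /=.
apply: leq_sum => x _; rewrite inE; case: (x \in _) => //=.
case: ifP => // /existsP[w /andP[w0 /forallP xw]].
have injw : injective (fun c : F => c *: w).
  move=> a b /eqP; rewrite -subr_eq0 -scalerBl scaler_eq0 (negPf w0) orbF subr_eq0.
  by move/eqP.
rewrite -(card_imset predT injw).
apply/subset_leq_card/subsetP => v /imsetP[c _ ->]; rewrite inE.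
by apply/forallP => i; rewrite dotZr (eqP (xw i)) mulr0.
Qed.

End Independence.


(** * Probabilities of too few and too many common neighbours *)

Section BadEvents.
Variables (F : finFieldType) (d k : nat) (t : F) (R : realFieldType).
Hypotheses (two_neq0 : 2 != 0 :> F) (t0 : t != 0).
Local Notation V := 'rV[F]_d.
Local Notation q := #|F|.
Variables (E Y : {set V}) (N : V -> {set V}) (D : nat).
Hypothesis cardN : {in Y, forall y, #|N y| = D}.
Hypothesis subN : {in Y, forall y x, x \in N y -> (x \in E) && at_distance t x y}.
Hypothesis subY : Y \subset E.
Hypotheses (E_gt0 : (0 < #|E|)%N) (largeY : (#|E| <= 2 * #|Y|)%N).
Hypotheses (D_gt0 : (0 < D)%N) (largeD : (#|E| <= 2 * q * D)%N).
Implicit Types (S : {set 'I_k}) (delta eps tau M : R).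

Local Notation bad := (bad_count Y N).
Local Notation com := (common (at_distance t) E).

Let q0 : 0 < q%:R :> R. Proof. by rewrite ltr0n cardF_gt0. Qed.

(** The factor [2^(#|S| + 1)] pays for replacing [#|E|] by [2 #|Y|] once and [#|E| / q] by [2 D] for
    each index in [S]. *)
Lemma bad_small delta eps S : 0 <= eps -> eps * 2 ^+ #|S|.+1 <= delta ->
  (bad (fun _ x => #|com x S|%:R < eps * #|E|%:R / q%:R ^+ #|S|))%:R
    <= delta * (#|Y|%:R * D%:R ^+ k).
Proof.
move=> eps0 le_eps; have n0 : 0 <= #|E|%:R :> R by rewrite ler0n.
have c0 : 0 <= eps * #|E|%:R / q%:R ^+ #|S|.
  by rewrite divr_ge0 ?mulr_ge0 ?exprn_ge0 // ltW.
apply: (le_trans (bad_count_small_common cardN subN subY S c0)).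
have Sk : (#|S| <= k)%N by rewrite -[k in (_ <= k)%N]card_ord max_card.
have -> : D%:R ^+ k = D%:R ^+ (k - #|S|) * D%:R ^+ #|S| :> R by rewrite -exprD subnK.
have nY : #|E|%:R <= 2 * #|Y|%:R :> R by rewrite -natrM ler_nat.
have nD : #|E|%:R / q%:R <= 2 * D%:R :> R.
  by rewrite ler_pdivrMr // mulrAC -!natrM ler_nat.
have powD : (#|E|%:R / q%:R) ^+ #|S| <= (2 * D%:R) ^+ #|S| :> R.
  by rewrite lerXn2r ?nnegrE ?divr_ge0 ?mulr_ge0 ?ler0n // ltW.
set a := D%:R ^+ (k - #|S|); have a0 : 0 <= a by rewrite exprn_ge0.
have -> : #|E|%:R ^+ #|S| * a * (eps * #|E|%:R / q%:R ^+ #|S|) =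
    a * (eps * #|E|%:R * (#|E|%:R / q%:R) ^+ #|S|).
  by rewrite exprMn exprVn; ring.
have -> : delta * (#|Y|%:R * (a * D%:R ^+ #|S|)) = a * (delta * #|Y|%:R * D%:R ^+ #|S|) by ring.
rewrite ler_wpM2l //.
apply: (@le_trans _ _ (eps * (2 * #|Y|%:R) * (2 * D%:R) ^+ #|S|)).
  by apply: ler_pM; rewrite ?mulr_ge0 ?exprn_ge0 ?divr_ge0 ?ler_wpM2l // ltW.
rewrite exprMn (_ : eps * _ * _ = eps * 2 ^+ #|S|.+1 * (#|Y|%:R * D%:R ^+ #|S|)).
  by rewrite -[X in _ <= X]mulrA ler_wpM2r // mulr_ge0 ?exprn_ge0 ?ler0n.
by rewrite exprS; ring.
Qed.

Lemma bad_large delta tau M S : 0 < tau -> M <= delta * tau ->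
    {in Y, forall y, \sum_(z in E) #|[set x in N y | at_distance t x z]|%:R ^+ #|S|
      <= D%:R ^+ #|S| * M} ->
  (bad (fun _ x => tau < #|com x S|%:R))%:R <= delta * (#|Y|%:R * D%:R ^+ k).
Proof.
move=> tau0 leM moment.
rewrite -(ler_pM2r tau0).
apply: (le_trans (bad_count_large_common (at_distance t) E cardN S tau)).
have Sk : (#|S| <= k)%N by rewrite -[k in (_ <= k)%N]card_ord max_card.
have -> : D%:R ^+ k = D%:R ^+ (k - #|S|) * D%:R ^+ #|S| :> R by rewrite -exprD subnK.
apply: (@le_trans _ _ (\sum_(y in Y) D%:R ^+ #|S| * M * D%:R ^+ (k - #|S|))).
  by apply: ler_sum => y yY; rewrite ler_wpM2r ?exprn_ge0 ?moment.
rewrite sumr_const -(mulr_natl (_ * _)).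
have -> : delta * (#|Y|%:R * (D%:R ^+ (k - #|S|) * D%:R ^+ #|S|)) * tau =
  #|Y|%:R * (D%:R ^+ #|S| * (delta * tau) * D%:R ^+ (k - #|S|)) by ring.
by rewrite !(ler_wpM2l, ler_wpM2r) ?exprn_ge0 ?ler0n.
Qed.

(** As [tau >= 2], only dependent tuples can be bad, and the moments of hyperplane sections of [N y]
    make these rare. *)
Lemma bad_top delta tau : (2 <= k)%N -> 2 <= tau ->
    2 ^+ k * (q%:R ^+ d / q%:R ^+ k + 4 * q%:R ^+ d / #|E|%:R) <= delta * q%:R ->
  (bad (fun _ x => tau < #|com x [set: 'I_k]|%:R))%:R <= delta * (#|Y|%:R * D%:R ^+ k).
Proof.
move=> k2 tau2 small; rewrite -(ler_pM2r q0).
have le1 : (bad (fun _ x => tau < #|com x [set: 'I_k]|%:R))%:R * q%:R <=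
    \sum_(y in Y) \sum_w #|[set v in N y | dot (v - y) w == 0]|%:R ^+ k :> R.
  rewrite -natrM /bad_count big_distrl /= natr_sum; apply: ler_sum => y yY.
  under [X in _ <= X]eq_bigr => w _ do rewrite -natrX.
  rewrite -natr_sum ler_nat mulnC; apply: leq_trans (@card_dependent_le F d k N y).
  rewrite leq_mul2l; apply/orP; right; apply/subset_leq_card/subsetP => x.
  rewrite !in_set => /andP[xN big_common]; rewrite xN /=.
  apply: contraTT big_common => indep; rewrite -leNgt.
  apply: le_trans tau2; rewrite ler_nat; apply: card_common_independent indep => // i.
  by have /andP[] := subN yY (forallP xN i).
apply: (le_trans le1).
apply: (@le_trans _ _ (\sum_(y in Y) D%:R ^+ k * (delta * q%:R))).
  apply: ler_sum => y yY; rewrite -(cardN yY).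
  have subX : {in N y, forall x, sqnorm (x - y) = t}.
    by move=> x /(subN yY)/andP[_ /eqP].
  have := @hyperplane_moment F d R t y (N y) E t0 subX.
  rewrite cardN // => /(_ D_gt0 E_gt0 largeD _ k2) h; apply: (le_trans h).
  by rewrite ler_wpM2l ?exprn_ge0 ?ler0n.
by rewrite sumr_const -(mulr_natl (_ * _)) le_eqVlt; apply/orP; left; apply/eqP; ring.
Qed.

End BadEvents.

(** * A shattered configuration *)

Lemma card_bigcup_le (I T : finType) (P : pred I) (A : I -> {set T}) :
  (#|\bigcup_(i | P i) A i| <= \sum_(i | P i) #|A i|)%N.
Proof.
elim/big_rec2: _ => [|i m B _ IH]; first by rewrite cards0.
by apply: leq_trans (leq_card_setU _ _) _; rewrite leq_add2l.
Qed.

Section Configuration.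
Variables (F : finFieldType) (d k : nat) (t : F) (R : realFieldType) (E : {set 'rV[F]_d}).
Hypotheses (two_neq0 : 2 != 0 :> F) (t0 : t != 0) (k2 : (2 <= k)%N).
Local Notation V := 'rV[F]_d.
Local Notation q := #|F|.
Local Notation adj := (at_distance t).
(** [delta] bounds the probability of each bad event, [eps] is the density guaranteed for common
    neighbourhoods, [beta] the proportion that one more adjacency may retain, and [K] measures how
    large [q] and [E] must be. *)
Variables (delta eps beta K : R).
Hypotheses (delta_gt0 : 0 < delta) (delta_small : delta * 2 ^+ (k + 2) <= 1).
Hypotheses (eps_gt0 : 0 < eps) (eps_small : eps * 2 ^+ k.+1 <= delta).
Hypotheses (beta_gt0 : 0 < beta) (beta_small : 4 * k%:R * beta <= eps).
Hypothesis K_large : 192 * 2 ^+ k <= (delta * beta) ^+ 2 * K.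
Hypothesis q_large : K <= q%:R.
Hypothesis E_large : K * q%:R ^+ (k - 1) <= #|E|%:R.
Hypothesis E_large2 : forall j, (0 < j <= k)%N -> (j < k)%N || (k < d)%N ->
  K * q%:R ^+ (d + j - 1) <= #|E|%:R ^+ 2.
Hypothesis kd : (k <= d)%N.

Let n : R := #|E|%:R.
Let Q : R := q%:R.
Let g := delta * beta.
Let c := 2 ^+ k : R.

Let c1 : 1 <= c. Proof. by apply: exprn_ege1; rewrite ler1n. Qed.
Let kc : k%:R <= c.
Proof. by rewrite /c -natrX ler_nat ltnW // ltn_expl. Qed.
Let k2R : 2 <= k%:R :> R. Proof. by rewrite ler_nat. Qed.
Let Q0 : 0 < Q. Proof. by rewrite /Q ltr0n cardF_gt0. Qed.
Let g0 : 0 < g. Proof. exact: mulr_gt0. Qed.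

Let delta1 : delta <= 1.
Proof.
by move: delta_small; rewrite exprD -/c; have : delta * 1 <= delta * c by [rewrite ler_pM2l]; lra.
Qed.
Let eps_delta : eps <= delta.
Proof.
by move: eps_small; rewrite exprS -/c; have : eps * 1 <= eps * c by [rewrite ler_pM2l]; have := eps_gt0; lra.
Qed.
Let beta_eps : 8 * beta <= eps.
Proof.
by move: beta_small; have : beta * 2 <= beta * k%:R by [rewrite ler_pM2l]; have := beta_gt0; lra.
Qed.
Let g_le : [/\ g <= delta, g <= eps & g <= beta].
Proof.
have b1 : beta <= 1.
  by have := beta_gt0; have := delta1; have := eps_delta; have := beta_eps; lra.
have gb : g <= beta by rewrite ger_pMl.
split=> //; first by rewrite ger_pMr.
by have := beta_gt0; have := beta_eps; lra.
Qed.

Let K0 : 0 < K.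
Proof.
have : 0 < g ^+ 2 * K by apply: lt_le_trans K_large; rewrite mulr_gt0 //; have := c1; rewrite /c; lra.
by rewrite pmulr_rgt0 // exprn_gt0.
Qed.

Let gK : 192 * c <= g * K.
Proof.
apply: (le_trans K_large); rewrite -/g expr2 -mulrA ger_pMl ?mulr_gt0 //.
by have := delta1; case: g_le => *; lra.
Qed.

Let gQ : 192 * c <= g * Q.
Proof. by apply: le_trans gK _; rewrite ler_pM2l. Qed.

Let n0 : 0 < n.
Proof. by apply: lt_le_trans E_large; rewrite mulr_gt0 ?exprn_gt0. Qed.

(** The case of one index: the bound of [codegree_sum] with [eta = g / 2] against
    [delta * tau 1 = g * n]. *)
Let threshold_small : (g / 2 * n + 4 / (g / 2) * (n / Q ^+ 2 + 6 * Q ^+ d / n)) <= g * n.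
Proof.
have h1 : 8 / g * (n / Q ^+ 2) <= g / 4 * n.
  have -> : 8 / g * (n / Q ^+ 2) = n / (4 * g * Q ^+ 2) * 32 by field; rewrite !lt0r_neq0.
  have -> : g / 4 * n = n / (4 * g * Q ^+ 2) * (g ^+ 2 * Q ^+ 2) by field; rewrite !lt0r_neq0.
  rewrite ler_wpM2l //; first by rewrite divr_ge0 ?mulr_ge0 ?exprn_ge0 // ltW.
  rewrite -exprMn expr2; have gQ1 : 192 <= g * Q by have := gQ; have := c1; lra.
  by apply: le_trans (ler_pM _ _ gQ1 gQ1); rewrite -?natrM ?ler_nat ?ler0n.
have h2 : 8 / g * (6 * Q ^+ d / n) <= g / 4 * n.
  have -> : 8 / g * (6 * Q ^+ d / n) = (4 * g * n)^-1 * (192 * Q ^+ d) by field; rewrite !lt0r_neq0.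
  have -> : g / 4 * n = (4 * g * n)^-1 * (g ^+ 2 * n ^+ 2) by field; rewrite !lt0r_neq0.
  rewrite ler_wpM2l //; first by rewrite invr_ge0 !mulr_ge0 // ltW.
  have hd : K * Q ^+ d <= n ^+ 2.
    have -> : d = (d + 1 - 1)%N by rewrite addnK.
    by apply: E_large2; rewrite ?(leq_trans _ k2) // k2.
  apply: (@le_trans _ _ (g ^+ 2 * (K * Q ^+ d))); last by rewrite ler_wpM2l // exprn_ge0 // ltW.
  rewrite mulrA ler_wpM2r ?exprn_ge0 ?(ltW Q0) //.
  by have := K_large; rewrite -/g -/c; have := c1; lra.
have -> : 4 / (g / 2) * (n / Q ^+ 2 + 6 * Q ^+ d / n) =
  8 / g * (n / Q ^+ 2) + 8 / g * (6 * Q ^+ d / n) by field; rewrite !lt0r_neq0.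
have : 0 <= g * n by rewrite mulr_ge0 // ltW.
by lra.
Qed.

(** The bound of [codegree_moment] against [delta * tau j]. Its second term consumes
    [K Q^(d + j - 1) <= n^2], hence the exclusion of [j = k = d]. *)
Let threshold_mid j : (1 < j <= k)%N -> (j < k)%N || (k < d)%N ->
  2 ^+ j * (n / Q ^+ j + 6 * Q ^+ d / n) <= g * n * Q / Q ^+ j.
Proof.
move=> /andP[j2 jk] jkd.
have Qj : 0 < Q ^+ j by rewrite exprn_gt0.
have pj : 0 < 2 ^+ j :> R by rewrite exprn_gt0.
have jc : 2 ^+ j <= c by apply: ler_weXn2l; rewrite ?ler1n.
have h1 : 2 ^+ j * (n / Q ^+ j) <= g / 2 * n * Q / Q ^+ j.
  have -> : 2 ^+ j * (n / Q ^+ j) = n / Q ^+ j * 2 ^+ j by rewrite mulrC.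
  have -> : g / 2 * n * Q / Q ^+ j = n / Q ^+ j * (g * Q / 2) by field; exact: lt0r_neq0.
  by rewrite ler_wpM2l ?divr_ge0 ?(ltW n0) ?(ltW Qj) //; have := gQ; have := c1; lra.
have h2 : 2 ^+ j * (6 * Q ^+ d / n) <= g / 2 * n * Q / Q ^+ j.
  have -> : 2 ^+ j * (6 * Q ^+ d / n) = (2 * n * Q ^+ j)^-1 * (12 * 2 ^+ j * (Q ^+ d * Q ^+ j)).
    by field; rewrite !lt0r_neq0.
  have -> : g / 2 * n * Q / Q ^+ j = (2 * n * Q ^+ j)^-1 * (g * n ^+ 2 * Q).
    by field; rewrite !lt0r_neq0.
  rewrite ler_wpM2l ?invr_ge0 ?mulr_ge0 ?(ltW n0) ?(ltW Qj) //.
  have hd : K * Q ^+ (d + j - 1) <= n ^+ 2 by apply: E_large2; rewrite // jk (ltnW j2).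
  have -> : Q ^+ d * Q ^+ j = Q ^+ (d + j - 1) * Q.
    by rewrite -exprD -exprSr subn1 prednK // addn_gt0 (ltnW j2) orbT.
  rewrite (mulrA _ _ Q) ler_wpM2r ?(ltW Q0) //.
  apply: (@le_trans _ _ (g * (K * Q ^+ (d + j - 1)))); last by rewrite ler_wpM2l ?(ltW g0).
  rewrite mulrA ler_wpM2r ?exprn_ge0 ?(ltW Q0) //.
  by have := gK; have := c1; lra.
rewrite mulrDr; apply: (le_trans (lerD h1 h2)).
rewrite le_eqVlt; apply/orP; left; apply/eqP; by field; exact: lt0r_neq0.
Qed.

Let nQ j : (j < k)%N -> K <= n / Q ^+ j.
Proof.
move=> jk; rewrite ler_pdivlMr ?exprn_gt0 //; apply: le_trans E_large.
rewrite ler_wpM2l ?(ltW K0) //; apply: ler_weXn2l; first by rewrite /Q ler1n cardF_gt0.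
by rewrite subn1 -ltnS prednK // (leq_trans _ k2).
Qed.

Let Y := [set y in E | (#|E| <= 2 * q * #|[set x in E | adj x y]|)%N].
Hypothesis largeY : (#|E| <= 2 * #|Y|)%N.

(** The least [m] with [#|E| <= 2 q m]. Neighbourhoods are cut down to exactly this size so that
    every centre has the same number of tuples. *)
Let D := (#|E|.-1 %/ (2 * q)).+1.

Let E_gt0 : (0 < #|E|)%N. Proof. by rewrite -(ltr0n R). Qed.

Let leD m : (#|E| <= 2 * q * m)%N = (D <= m)%N.
Proof.
by rewrite /D ltn_divLR ?muln_gt0 ?cardF_gt0 // -{1}(prednK E_gt0) mulnC.
Qed.

Let N y := [set x in take D (enum [set x in E | adj x y])].

Let cardN : {in Y, forall y, #|N y| = D}.
Proof.
move=> y; rewrite inE leD => /andP[_ degy]; rewrite cardsE.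
have /card_uniqP -> := take_uniq D (enum_uniq (mem [set x in E | adj x y])).
by rewrite size_takel // -cardE.
Qed.

Let subN : {in Y, forall y x, x \in N y -> (x \in E) && adj x y}.
Proof. by move=> y _ x; rewrite inE => /mem_take; rewrite mem_enum inE. Qed.

Let subY : Y \subset E.
Proof. by apply/subsetP => y; rewrite inE => /andP[]. Qed.

(** This is [beta] times [n / Q^(j - 1)], the order of magnitude one index earlier. *)
Let tau j : R := beta * n * Q / Q ^+ j.

Let tau0 j : 0 < tau j.
Proof. by rewrite divr_gt0 ?mulr_gt0 ?exprn_gt0. Qed.

Let com := @common _ adj k E.

Let bad (i : {set 'I_k} + {set 'I_k}) (y : V) (x : {ffun 'I_k -> V}) : bool :=
  match i with
  | inl A => (#|A| < k)%N && (#|com x A|%:R < eps * n / Q ^+ #|A|)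
  | inr A => (0 < #|A|)%N && (tau #|A| < #|com x A|%:R)
  end.

Let bad_rare i : (bad_count Y N (bad i))%:R <= delta * (#|Y|%:R * D%:R ^+ k).
Proof.
have D_gt0 : (0 < D)%N by [].
have nD : (#|E| <= 2 * q * D)%N by rewrite leD.
have rhs0 : 0 <= delta * (#|Y|%:R * D%:R ^+ k) by rewrite !mulr_ge0 ?exprn_ge0 ?ler0n // ltW.
case: i => S; rewrite /bad.
  case: ltnP => Sk /=; last first.
    by rewrite /bad_count big1 // => y _; apply: eq_card0 => x; rewrite !inE andbF.
  apply: bad_small => //; first exact: ltW.
  apply: le_trans eps_small; rewrite ler_wpM2l ?(ltW eps_gt0) //.
  by apply: ler_weXn2l; rewrite ?ler1n // ltnS ltnW.
case: posnP => S0 /=.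
  by rewrite /bad_count big1 // => y _; apply: eq_card0 => x; rewrite !inE andbF.
have Sk : (#|S| <= k)%N by rewrite -[k in (_ <= k)%N]card_ord max_card.
have subX y : y \in Y -> {in N y, forall x, sqnorm (x - y) = t}.
  by move=> yY x /(subN yY)/andP[_ /eqP].
have gtau j : delta * tau j = g * n * Q / Q ^+ j by rewrite /tau /g; ring.
have [Skd|] := boolP ((#|S| < k)%N || (k < d)%N).
  case: (ltnP 1 #|S|) => [S2|S1].
    apply: (bad_large cardN (M := 2 ^+ #|S| * (n / Q ^+ #|S| + 6 * Q ^+ d / n))) => //.
      by rewrite gtau threshold_mid // S2.
    move=> y yY; rewrite -(cardN yY); apply: (codegree_moment R two_neq0 t0 (subX _ yY)) => //.
      by rewrite cardN.
    by rewrite cardN.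
  have {S0 S1} S1 : #|S| = 1%N by apply/eqP; rewrite eqn_leq S1.
  apply: (bad_large cardN (M := g / 2 * n + 4 / (g / 2) * (n / Q ^+ 2 + 6 * Q ^+ d / n))) => //.
    by rewrite gtau S1 expr1 mulfK ?lt0r_neq0.
  move=> y yY; rewrite S1 expr1 -(cardN yY); under eq_bigr => z _ do rewrite expr1.
  apply: (codegree_sum two_neq0 t0 (subX _ yY)) => //.
  - by rewrite cardN.
  - by rewrite cardN.
  - by rewrite divr_gt0.
(* Only [S = setT] with [k = d] remains, outside the range of [E_large2]; [bad_top] handles it. *)
rewrite negb_or -!leqNgt => /andP[kS dk].
have kE : k = d by apply/eqP; rewrite eqn_leq kd.
have ST : S = setT.
  by apply/eqP; rewrite eqEcard subsetT cardsT card_ord.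
have SE : #|S| = k by apply/eqP; rewrite eqn_leq Sk.
have nk : K <= n * Q / Q ^+ k.
  have -> : n * Q / Q ^+ k = n / Q ^+ (k - 1).
    rewrite -[k in LHS](subnK (ltnW k2)) exprD expr1.
    by field; rewrite !lt0r_neq0 // exprn_gt0.
  by apply: nQ; rewrite subn1 prednK // ltnW.
have [gd ge gb] := g_le.
have K192 : [/\ 192 * c <= delta * K, 192 * c <= beta * K & 192 * c <= eps * K].
  by split; apply: (le_trans gK); rewrite ler_wpM2r // ltW.
have [dK bK eK] := K192.
rewrite SE ST; apply: (bad_top two_neq0 t0 cardN) => //.
  have -> : tau k = beta * (n * Q / Q ^+ k) by rewrite /tau !mulrA.
  apply: (@le_trans _ _ (beta * K)).
    by have := c1; lra.
  by rewrite ler_wpM2l // ltW.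
have -> : q%:R ^+ d = Q ^+ k by rewrite kE.
rewrite -/Q -/n -/c divff ?lt0r_neq0 ?exprn_gt0 //.
have qn : Q ^+ k / n <= Q / K.
  rewrite ler_pdivrMr // mulrAC ler_pdivlMr //.
  have -> : Q ^+ k * K = Q * (K * Q ^+ (k - 1)).
    by rewrite -[k in LHS](subnK (ltnW k2)) exprD expr1; ring.
  by rewrite ler_wpM2l // ltW.
have dQ : delta * K <= delta * Q by rewrite ler_wpM2l // ltW.
have qK : c * (4 * (Q / K)) <= delta * Q / 2.
  have -> : c * (4 * (Q / K)) = Q / (2 * K) * (8 * c) by field; exact: lt0r_neq0.
  have -> : delta * Q / 2 = Q / (2 * K) * (delta * K) by field; exact: lt0r_neq0.
  rewrite ler_wpM2l ?divr_ge0 ?mulr_ge0 ?(ltW Q0) ?(ltW K0) //.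
  by have := c1; lra.
have -> : 4 * Q ^+ k / n = 4 * (Q ^+ k / n) by rewrite mulrA.
have : c * (4 * (Q ^+ k / n)) <= c * (4 * (Q / K)).
  by rewrite !ler_wpM2l //; have := c1; lra.
by rewrite mulrDr mulr1; have := c1; lra.
Qed.

(** A good tuple is shattered by sieving: from the common neighbours of the [x i] with [i] in [S],
    remove the neighbours of every other [x j]. The points [x j] are removed as well because the
    shattering uses closed neighbourhoods. *)
Lemma shattering_configuration : exists x : {ffun 'I_k -> V},
  (forall i, x i \in E) /\
  forall S : {set 'I_k}, exists2 z, z \in E &
    forall i, (adj (x i) z = (i \in S)) /\ z != x i.
Proof.
have adj_irr (z : V) : adj z z = false.
  by rewrite /at_distance subrr sqnorm0 eq_sym; apply/negbTE.
have Y0 : (0 < #|Y|)%N by rewrite lt0n; apply: contraTneq largeY => ->; rewrite muln0 -ltnNge.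
(* There are [2^(k + 1)] bad events, so [delta_small] leaves a total probability of at most 1/2. *)
have bads : #|{: {set 'I_k} + {set 'I_k}}|%:R * delta < 1.
  rewrite card_sum -cardsT -powersetT card_powerset cardsT card_ord addnn -muln2.
  rewrite natrM natrX -/c; move: delta_small; rewrite exprD -/c.
  have : 0 < c * delta by rewrite mulr_gt0 //; have := c1; lra.
  by lra.
have [y [x [yY xN good]]] := exists_good_tuple cardN bad_rare bads Y0 isT.
have xiN i : (x i \in E) && adj (x i) y.
  by apply: (subN yY); move: xN; rewrite inE => /forallP.
exists x; split; first by move=> i; have /andP[] := xiN i.
have yE : y \in E by apply: (subsetP subY).
move=> S; have Sk : (#|S| <= k)%N by rewrite -[k in (_ <= k)%N]card_ord max_card.
move: Sk; rewrite leq_eqVlt => /orP[/eqP Sk|Sk].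
  have ST : S = setT by apply/eqP; rewrite eqEcard subsetT cardsT card_ord Sk /=.
  exists y => // i; have /andP[_ xy] := xiN i; rewrite ST inE xy; split=> //.
  by apply: contraTneq xy => <-; rewrite adj_irr.
have large : eps * n / Q ^+ #|S| <= #|com x S|%:R.
  by have := good (inl S); rewrite /bad Sk /= -leNgt.
have small j : j \notin S -> #|com x (j |: S)|%:R <= beta * (n / Q ^+ #|S|).
  move=> jS; have := good (inr (j |: S)); rewrite /bad cardsU1 jS add1n /= -leNgt /tau => h.
  apply: (le_trans h); rewrite exprS le_eqVlt; apply/orP; left; apply/eqP.
  by field; rewrite !lt0r_neq0 ?exprn_gt0.
pose B := \bigcup_(j | j \notin S) (x j |: com x (j |: S)).
have [/existsP[z /andP[zC zB]]|/existsPn noz] := boolP [exists z, (z \in com x S) && (z \notin B)].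
  have /commonP[zE xz] := zC; exists z => // i.
  have [iS|iS] := boolP (i \in S).
    by rewrite xz //; split=> //; apply: contraTneq (xz i iS) => ->; rewrite adj_irr.
  have zi : z \notin x i |: com x (i |: S).
    by apply: contra zB => zi; apply/bigcupP; exists i.
  move: zi; rewrite !inE negb_or => /andP[zxi h]; split=> //.
  apply/negbTE; apply: contra h => iz; rewrite zE; apply/forall_inP => j.
  by rewrite !inE => /orP[/eqP->|/xz].
(* Otherwise, with [u = n / Q^#|S| >= K], the common neighbourhood has at least [eps u] points but
   at most [k (1 + beta u)], while [k beta u <= eps u / 4] and [k <= eps u / 192]. *)
exfalso.
have CB : (#|com x S| <= #|B|)%N.
  by apply/subset_leq_card/subsetP => z zC; have := noz z; rewrite zC negbK.
have : #|com x S|%:R <= \sum_(j : 'I_k) (1 + beta * (n / Q ^+ #|S|)) :> R.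
  apply: (@le_trans _ _ (\sum_(j | j \notin S) #|x j |: com x (j |: S)|)%N%:R).
    by rewrite ler_nat (leq_trans CB) // card_bigcup_le.
  rewrite natr_sum big_mkcond; apply: ler_sum => j _.
  have b0 : 0 <= beta * (n / Q ^+ #|S|) by rewrite mulr_ge0 ?divr_ge0 ?exprn_ge0 // ltW.
  case: ifP => [jS|_]; last by lra.
  have := small _ jS; have : #|x j |: com x (j |: S)|%:R <= 1 + #|com x (j |: S)|%:R :> R.
    by rewrite nat1r ler_nat cardsU1; case: (_ \notin _).
  by lra.
rewrite sumr_const card_ord -(mulr_natl (_ + _)).
have := nQ Sk; have := beta_small; have := kc; have := c1; have := gK; have := K0.
have [_ ge _] := g_le; move: large; rewrite -mulrA.
move: (n / Q ^+ #|S|) => u large K_gt0 gKc c_ge1 k_le b_small Ku upper.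
have u0 : 0 < u by lra.
have h1 : 4 * k%:R * beta * u <= eps * u by rewrite ler_wpM2r // ltW.
have h2 : g * K <= eps * u.
  by apply: ler_pM => //; apply: ltW.
lra.
Qed.

End Configuration.

(** * The VC-dimension *)

(** The singleton patterns already force [x] to be injective, so its image is a shattered set of
    exactly [k] points. *)
Lemma graph_VCdim_ge (V : finType) (adj : rel V) (k : nat) (x : 'I_k -> V) :
    (forall S : {set 'I_k}, exists z, forall i,
       (x i \in closed_neighborhood adj z) = (i \in S)) ->
  (k <= graph_VCdim adj)%N.
Proof.
move=> pattern.
have xI : injective x.
  move=> i j xij; have [z h] := pattern [set i].
  by have := h j; rewrite -xij h !inE eqxx => /esym/eqP.
pose A := [set x i | i : 'I_k].
have cardA : #|A| = k by rewrite card_imset // card_ord.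
rewrite -[k in (k <= _)%N]cardA; apply: leq_bigmax_cond.
apply/eqP/setP => f; rewrite inE; apply/imsetP.
have memA i : x i \in A by apply: imset_f.
pose xA i : {v | v \in A} := exist _ (x i) (memA i).
have [z h] := pattern [set i | f (xA i)].
exists (indicator (closed_neighborhood adj z)); first exact: imset_f.
apply/ffunP => -[v vA]; rewrite !ffunE /=.
have /imsetP[i _ vE] := vA.
have -> : exist _ v vA = xA i by apply: val_inj.
by rewrite [in RHS]vE h inE.
Qed.

Lemma sqr_large_le (R : realFieldType) (C q n : R) (a b : nat) :
  1 <= C -> 1 <= q -> C * q ^+ a < n -> (b <= 2 * a)%N -> C * q ^+ b <= n ^+ 2.
Proof.
move=> C1 q1 large ba; have C0 : 0 <= C by lra.
have q0 : 0 <= q by lra.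
apply: (@le_trans _ _ ((C * q ^+ a) ^+ 2)); last first.
  by rewrite lerXn2r ?nnegrE ?mulr_ge0 ?exprn_ge0 ?(ltW large) //
     (le_trans _ (ltW large)) ?mulr_ge0 ?exprn_ge0.
rewrite exprMn -exprM mulnC; apply: ler_pM; rewrite ?exprn_ge0 //.
  by rewrite expr2 ler_peMl.
exact: ler_weXn2l.
Qed.

Lemma degrees_regular (R : realFieldType) (F : finFieldType) (k d : nat) (t : F)
    (E : {set 'rV[F]_d}) (C : R) :
    2 != 0 :> F -> t != 0 -> (3 <= k <= d)%N -> 144 <= C ->
    C * #|F|%:R ^+ (d - (d - k) %/ 3 - 1) < #|E|%:R ->
  (#|E| <= 2 * #|[set y in E | #|E| <= 2 * #|F| * #|[set x in E | at_distance t x y]|]|)%N.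
Proof.
move=> two0 t0 /andP[k3 kd] C144 largeE; have C1 : 1 <= C by lra.
rewrite -(ler_nat R) natrM.
have q1 : 1 <= #|F|%:R :> R by rewrite ler1n cardF_gt0.
have n0 : 0 < #|E|%:R :> R.
  by apply: le_lt_trans largeE; rewrite mulr_ge0 ?exprn_ge0 ?ler0n //; lra.
(* The lifted variance needs [d + 2 <= 2 a] for the exponent [a] of [q]; this holds for [d >= 4],
   but for [d = 3] it would read [5 <= 4]. *)
case: (ltnP 3 d) => [d4|d3].
  apply: (regular_degree (degree_variance R two0 E t)).
  have -> : 8 * #|F|%:R ^+ 2 * (#|E|%:R * #|F|%:R ^+ d) = #|E|%:R * (8 * #|F|%:R ^+ (2 + d)) :> R.
    by rewrite exprD; ring.
  rewrite exprS ler_pM2l //.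
  apply: le_trans (sqr_large_le C1 q1 largeE (b := 2 + d) _).
    by rewrite ler_wpM2r ?exprn_ge0 //; lra.
  by clear -k3 kd d4; lia.
have dE : d = 3%N by apply/eqP; rewrite eqn_leq d3 (leq_trans k3).
have kE : k = 3%N by apply/eqP; rewrite eqn_leq k3 (leq_trans kd) // dE.
move: E largeE n0; rewrite {k k3 kd d3}kE {d}dE => E largeE n0.
have nq : 144 * #|F|%:R ^+ 2 <= #|E|%:R :> R.
  by apply: ltW; apply: le_lt_trans largeE; rewrite ler_wpM2r ?exprn_ge0 //; lra.
have nq' : 100 * #|F|%:R ^+ 2 <= #|E|%:R :> R.
  by apply: le_trans nq; rewrite ler_wpM2r ?exprn_ge0 // ler_nat.
apply: (regular_degree (sphere_variance_large two0 t0 nq')).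
(* This is the origin of [144 = 8 * 18]. *)
have -> : 8 * #|F|%:R ^+ 2 * (18 * #|E|%:R ^+ 2) = #|E|%:R ^+ 2 * (144 * #|F|%:R ^+ 2) :> R by ring.
by rewrite [X in _ <= X]exprSr ler_pM2l // exprn_gt0.
Qed.

Theorem theorem1p4 (R : realType) (k d : nat) (hk : (3 <= k)%N)
    (hkd : (k <= d)%N) :
  exists2 C : R, 0 < C &
    forall (F : finFieldType) (t : F) (E : {set 'rV[F]_d}),
      odd #|F| -> t != 0 ->
      C * #|F|%:R ^+ (d - (d - k) %/ 3 - 1) < #|E|%:R ->
      (k <= graph_VCdim (@distance_graph F d t E))%N.
Proof.
(* Each constant is chosen to turn the corresponding smallness or largeness hypothesis of the
   configuration into an equality. *)
pose delta : R := (2 ^+ (k + 2))^-1; pose eps := delta / 2 ^+ k.+1.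
pose beta := eps / (4 * k%:R); pose K := 192 * 2 ^+ k / (delta * beta) ^+ 2.
have k0 : 0 < k%:R :> R by rewrite ltr0n (leq_trans _ hk).
have p0 j : 0 < 2 ^+ j :> R by rewrite exprn_gt0.
have delta0 : 0 < delta by rewrite invr_gt0.
have eps0 : 0 < eps by rewrite divr_gt0.
have beta0 : 0 < beta by rewrite divr_gt0 // mulr_gt0.
have K0 : 0 < K by apply: divr_gt0; [rewrite mulr_gt0|rewrite exprn_gt0 // mulr_gt0].
have Kd0 : 0 < K ^+ d by rewrite exprn_gt0.
(* The summand 144 serves the degrees, [K] the size conditions on [E], and [K^d] excludes [q < K],
   where [#|E| <= q^d] is too small. *)
exists (144 + K + K ^+ d) => [|F t E oddF t0 largeE]; first by lra.
set C := 144 + K + K ^+ d in largeE.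
have two0 := odd_card_two_neq0 oddF.
have q1 : 1 <= #|F|%:R :> R by rewrite ler1n cardF_gt0.
have CK : K <= C by rewrite /C; lra.
have C144 : 144 <= C by rewrite /C; lra.
have C1 : 1 <= C by lra.
have CKd : K ^+ d <= C by rewrite /C; lra.
clearbody C.
have qK : K <= #|F|%:R.
  rewrite leNgt; apply/negP => qK.
  have : #|F|%:R ^+ d <= K ^+ d by rewrite lerXn2r ?nnegrE ?ler0n ?(ltW K0) ?(ltW qK).
  have : #|E|%:R <= #|F|%:R ^+ d :> R by rewrite -natrX ler_nat -card_rV max_card.
  have : C * 1 <= C * #|F|%:R ^+ (d - (d - k) %/ 3 - 1).
    by rewrite ler_wpM2l ?exprn_ege1 //; lra.
  by lra.
have E_large : K * #|F|%:R ^+ (k - 1) <= #|E|%:R.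
  apply: (le_trans _ (ltW largeE)); apply: ler_pM; rewrite ?exprn_ge0 ?(ltW K0) //.
  by apply: ler_weXn2l => //; clear -hk hkd; lia.
(* With [m = d - k], the comparison of exponents follows from [2 (m %/ 3) <= m] for [j < k] and from
   [2 (m %/ 3) + 1 <= m] for [j = k < d]; it fails for [j = k = d]. *)
have E_large2 j : (0 < j <= k)%N -> (j < k)%N || (k < d)%N ->
    K * #|F|%:R ^+ (d + j - 1) <= #|E|%:R ^+ 2.
  move=> jk jkd; apply: le_trans (sqr_large_le C1 q1 largeE (b := d + j - 1) _).
    by rewrite ler_wpM2r ?exprn_ge0.
  by clear -hk hkd jk jkd; lia.
have regular := degrees_regular two0 t0 (introT andP (conj hk hkd)) C144 largeE.
have [||||x [xE pattern]] := @shattering_configuration F d k t R E two0 t0 (ltnW hk)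
  delta eps beta K delta0 _ eps0 _ beta0 _ _ qK E_large E_large2 hkd regular.
- by rewrite mulVf // lt0r_neq0.
- by rewrite divfK // lt0r_neq0.
- by rewrite mulrC divfK // lt0r_neq0 // mulr_gt0.
- by rewrite [X in _ <= X]mulrC divfK // expf_neq0 // mulf_neq0 // lt0r_neq0.
apply: (@graph_VCdim_ge _ _ k (fun i => exist _ (x i) (xE i))) => S.
have [z zE h] := pattern S; exists (exist _ z zE) => i; have [<- zx] := h i.
rewrite !inE /distance_graph /= -val_eqE /= eq_sym (negPf zx) /=.
by rewrite /at_distance sqnormBC.
Qed.
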